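(* Let $\kappa\in\mathbb{R}\setminus\{1,-6\}$ and consider the functional of Cayley forms $$S_\kappa[\Phi]=\frac16\int\frac{(6-5\kappa)\,TJ_3(T)+6\kappa\,T^2}{6-(5+\kappa)\kappa}\,v_\Phi ,$$ where $T$ is the torsion 3-form of $\Phi$. Let $\Phi$ be a constant Cayley form on $\mathbb{R}^8$ with flat metric $\eta_{ab}$, and consider perturbations $$\phi_{abcd}=-4\left(h_{[a}{}^{p}+\tfrac14\xi_{[a}{}^{p}\right)\Phi_{bcd]p},$$ with $h_{ab}$ symmetric, $\xi_{ab}\in\Lambda^2_7$, $h=\eta^{ab}h_{ab}$. Then the linearised action $S^{(2)}[\phi]=\int\mathcal{L}^{(2)}$, obtained from $S_\kappa$ by replacing $T$ with its first-order variation $t$ and all other quantities with their background values, satisfies, modulo total derivatives, $$\left(1-\frac{5\kappa}{6}-\frac{\kappa^2}{6}\right)\mathcal{L}^{(2)}=\rho\,\mathcal{L}_{GR}+\mu\,\mathcal{L}',\qquad \rho=1+\frac{\kappa}{6},\quad\mu=\frac23\left(1+\frac{\kappa}{2}\right),$$ where $$\mathcal{L}_{GR}=\frac12(\partial_ah_{bc})^2-\frac12(\partial_ah)^2-h\,\partial^a\partial^bh_{ab}-(\partial^ah_{ab})^2,$$ $$\mathcal{L}'=\frac12(\partial_ah)^2+h\,\partial^a\partial^bh_{ab}+\frac12(\partial^ah_{ab})^2+\frac1{16}(\partial_c\xi_{ab})^2-\partial_bh^{ba}\,\partial^c\xi_{ca}.$$ Explicitly, $$\left(1-\frac{5\kappa}{6}-\frac{\kappa^2}{6}\right)\mathcal{L}^{(2)}=\frac12\left(1+\frac{\kappa}{6}\right)(\partial_ah_{bc})^2-\frac16\left(1-\frac{\kappa}{2}\right)(\partial_ah)^2-\frac13\left(1-\frac{\kappa}{2}\right)h\,\partial^a\partial^bh_{ab}-\frac23(\partial^ah_{ab})^2$$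 $$+\frac1{24}\left(1+\frac{\kappa}{2}\right)(\partial_a\xi_{bc})^2-\frac23\left(1+\frac{\kappa}{2}\right)\partial_bh^{ba}\,\partial^c\xi_{ca}.$$
   Context: A Cayley form ($\mathrm{Spin}(7)$-structure) on an 8-manifold is a 4-form $\Phi$ which at each point lies in a fixed $\mathrm{GL}(8,\mathbb{R})$-orbit of 4-forms with stabiliser $\mathrm{Spin}(7)$. It determines a Riemannian metric $g$ and an orientation. The conventions are fixed by the identity (all contractions and index raisings with $g$) $$\Phi_{ijkp}\Phi_{abc}{}^{p}= g_{ia}g_{jb}g_{kc}+g_{ib}g_{jc}g_{ka}+g_{ic}g_{ja}g_{kb}-g_{ia}g_{jc}g_{kb}-g_{ic}g_{jb}g_{ka}-g_{ib}g_{ja}g_{kc}$$ $$-g_{ia}\Phi_{jkbc}-g_{ja}\Phi_{kibc}-g_{ka}\Phi_{ijbc}-g_{ib}\Phi_{jkca}-g_{jb}\Phi_{kica}-g_{kb}\Phi_{ijca}-g_{ic}\Phi_{jkab}-g_{jc}\Phi_{kiab}-g_{kc}\Phi_{ijab},$$ and $\Phi$ is self-dual: $\frac1{4!}\epsilon_{ijkl}{}^{abcd}\Phi_{abcd}=\Phi_{ijkl}$, with $\epsilon$ the volume form of $g$. Square brackets denote antisymmetrisation with weight one; indices between vertical bars are excluded from it. $v_\Phi$ is the volume form of $g$. The torsion 3-form $T$ of $\Phi$ is the 3-form with $\nabla_i\Phi_{abcd}=4\,T_{i[a}{}^{p}\Phi_{|p|bcd]}$, $\nabla$ being the Levi-Civita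 connection of $g$. $J_3(\gamma)_{ijk}=\frac32\Phi_{[ij}{}^{pq}\gamma_{k]pq}$ on 3-forms; $T^2=T_{abc}T^{abc}$, $TJ_3(T)=T^{abc}J_3(T)_{abc}$. $\Lambda^2_7\subset\Lambda^2$ is the eigenspace with eigenvalue $-3$ of $J_2(\beta)_{ij}=\frac12\Phi_{ij}{}^{ab}\beta_{ab}$. For any tensor $t$, $(t_{a_1\dots a_k})^2$ means $t_{a_1\dots a_k}t^{a_1\dots a_k}$. The torsion of the constant background vanishes; $t$ is the first-order variation of $T$ under $\Phi\to\Phi+\phi$ with $\phi$ tangent to the space of Cayley forms. *)

(* Defs.v *)
From mathcomp Require Import all_boot all_order all_algebra all_fingroup.
From mathcomp Require Import all_classical all_reals all_analysis.

Set Implicit Arguments.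
Unset Strict Implicit.
Unset Printing Implicit Defensive.

Import Order.TTheory GRing.Theory Num.Theory.
Import numFieldNormedType.Exports.
Local Open Scope classical_set_scope.
Local Open Scope ring_scope.

(* Covariant tensors on R^8 are given by their components in the Cartesian
   frame.  Rank-2 tensors are matrices, so that inverse and determinant of a
   metric are available. *)
Notation space R := 'rV[R]_8.
Notation tensor2 R := 'M[R]_8.
Notation tensor3 R := ('I_8 -> 'I_8 -> 'I_8 -> R).
Notation tensor4 R := ('I_8 -> 'I_8 -> 'I_8 -> 'I_8 -> R).

(* C^k in terms of iterated directional derivatives; in finite dimension this
   is the usual notion.  It is used on R^8 and on R x R^8. *)
Fixpoint Ck (R : realType) (V : normedModType R) (k : nat) (f : V -> R) : Prop :=
  continuous f /\
  if k is k'.+1 then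
    forall v : V, (forall x, derivable f x v) /\ Ck k' (fun x => 'D_v f x)
  else True.

Definition smooth (R : realType) (V : normedModType R) (f : V -> R) : Prop :=
  forall k, Ck k f.

Definition pd (R : realType) (i : 'I_8) (f : space R -> R) (x : space R) : R :=
  'D_(delta_mx 0 i) f x.

(* Antisymmetrisation with weight one. *)
Definition alt3 (R : realType) (X : tensor3 R) : tensor3 R := fun a b c =>
  (3`!)%:R^-1 * \sum_(s : 'S_3) (-1) ^+ s *
    (let v m := tnth [tuple a; b; c] (s m) in
     X (v (inord 0)) (v (inord 1)) (v (inord 2))).

Definition alt4 (R : realType) (X : tensor4 R) : tensor4 R := fun a b c d =>
  (4`!)%:R^-1 * \sum_(s : 'S_4) (-1) ^+ s *
    (let v m := tnth [tuple a; b; c; d] (s m) in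
     X (v (inord 0)) (v (inord 1)) (v (inord 2)) (v (inord 3))).

Definition is_form3 (R : realType) (X : tensor3 R) : Prop :=
  forall a b c, X b a c = - X a b c /\ X a c b = - X a b c.

(* Component (a, b, c, d) of e^i /\ e^j /\ e^k /\ e^l for I = [:: i; j; k; l],
   indices counted from 0. *)
Definition wedge4 (R : realType) (I : seq nat) : tensor4 R := fun a b c d =>
  \det (\matrix_(m < 4, n < 4)
     (nth 0%N I m == tnth [tuple a; b; c; d] n :> nat)%:R : 'M[R]_4).

(* The reference Cayley form.  The overall sign is the one for which the
   identity [cayley_identity] below holds with g the Euclidean metric; it is
   self-dual for the standard orientation. *)
Definition cayley0 (R : realType) : tensor4 R := fun a b c d =>
  \sum_(I <- [:: [:: 0; 2; 5; 7]; [:: 0; 3; 4; 7]; [:: 0; 3; 5; 6];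
                 [:: 1; 2; 4; 7]; [:: 1; 2; 5; 6]; [:: 1; 3; 4; 6]]%N)
    wedge4 R I a b c d
  - \sum_(I <- [:: [:: 0; 1; 2; 3]; [:: 0; 1; 4; 5]; [:: 0; 1; 6; 7];
                   [:: 0; 2; 4; 6]; [:: 1; 3; 5; 7];
                   [:: 2; 3; 4; 5]; [:: 2; 3; 6; 7]; [:: 4; 5; 6; 7]]%N)
    wedge4 R I a b c d.

(* The GL(8,R)-orbit of the reference form, whose stabiliser is Spin(7). *)
Definition cayley_form (R : realType) (Phi : tensor4 R) : Prop :=
  exists2 A : 'M[R]_8, A \in unitmx &
    forall a b c d, Phi a b c d =
      \sum_i \sum_j \sum_k \sum_l
        A i a * A j b * A k c * A l d * cayley0 R i j k l.

Definition cayley_identity (R : realType) (g : tensor2 R) (Phi : tensor4 R) : Prop :=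
  forall i j k a b c,
    \sum_p \sum_q Phi i j k p * invmx g p q * Phi a b c q =
      g i a * g j b * g k c + g i b * g j c * g k a + g i c * g j a * g k b
    - g i a * g j c * g k b - g i c * g j b * g k a - g i b * g j a * g k c
    - g i a * Phi j k b c - g j a * Phi k i b c - g k a * Phi i j b c
    - g i b * Phi j k c a - g j b * Phi k i c a - g k b * Phi i j c a
    - g i c * Phi j k a b - g j c * Phi k i a b - g k c * Phi i j a b.

(* Volume form of g for the orientation of R^8 with sign (-1)^o; the
   determinant is the Levi-Civita symbol of the indices v. *)
Definition volume_form (R : realType) (g : tensor2 R) (o : bool)
    (v : 8.-tuple 'I_8) : R :=
  (-1) ^+ o * Num.sqrt (\det g) *
    \det (\matrix_(m < 8, n < 8) (tnth v m == n)%:R : 'M[R]_8).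

Definition raise4 (R : realType) (g : tensor2 R) (X : tensor4 R) : tensor4 R :=
  fun a b c d => \sum_a' \sum_b' \sum_c' \sum_d'
    invmx g a a' * invmx g b b' * invmx g c c' * invmx g d d' * X a' b' c' d'.

Definition self_dual (R : realType) (g : tensor2 R) (o : bool) (Phi : tensor4 R) : Prop :=
  forall i j k l,
    (4`!)%:R^-1 * (\sum_a \sum_b \sum_c \sum_d
      volume_form g o [tuple i; j; k; l; a; b; c; d] * raise4 g Phi a b c d)
    = Phi i j k l.

(* g is the Riemannian metric (at one point) of the Cayley form Phi; the
   orientation determined by Phi is the o of the last clause. *)
Definition metric_of (R : realType) (Phi : tensor4 R) (g : tensor2 R) : Prop :=
  [/\ g^T = g,
      forall v : 'rV[R]_8, v != 0 -> 0 < (v *m g *m v^T) 0 0,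
      cayley_identity g Phi &
      exists o, self_dual g o Phi].

(* Gamma^p_{ij} *)
Definition christoffel (R : realType) (g : space R -> tensor2 R) (x : space R)
    (p i j : 'I_8) : R :=
  2^-1 * \sum_q invmx (g x) p q *
    (pd i (fun y => g y q j) x + pd j (fun y => g y q i) x
     - pd q (fun y => g y i j) x).

Definition nabla (R : realType) (g : space R -> tensor2 R)
    (Phi : space R -> tensor4 R) (x : space R) (i : 'I_8) : tensor4 R :=
  fun a b c d =>
    pd i (fun y => Phi y a b c d) x
    - \sum_p (christoffel g x p i a * Phi x p b c d
            + christoffel g x p i b * Phi x a p c d
            + christoffel g x p i c * Phi x a b p d
            + christoffel g x p i d * Phi x a b c p).

Definition is_torsion (R : realType) (Phi : space R -> tensor4 R)
    (g : space R -> tensor2 R) (T : space R -> tensor3 R) : Prop :=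
  forall x, is_form3 (T x) /\
    forall i a b c d, nabla g Phi x i a b c d =
      4 * alt4 (fun a b c d =>
            \sum_p \sum_q T x i a q * invmx (g x) q p * Phi x p b c d) a b c d.

(* phi is the variation at s = 0, and t the corresponding first-order variation
   of the torsion, of a smooth family (Phi_s) of Cayley forms starting at the
   constant form Phi.  The metric is required to be smooth in (s, x) as well;
   it is a smooth function of Phi_s, so this does not restrict the family. *)
Definition torsion_variation (R : realType) (Phi : tensor4 R)
    (phi : space R -> tensor4 R) (t : space R -> tensor3 R) : Prop :=
  exists (Phis : R -> space R -> tensor4 R) (gs : R -> space R -> tensor2 R)
         (Ts : R -> space R -> tensor3 R),
    (forall a b c d, smooth (fun z : R * space R => Phis z.1 z.2 a b c d)) /\
    (forall a b, smooth (fun z : R * space R => gs z.1 z.2 a b)) /\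
    (forall s x, cayley_form (Phis s x) /\ metric_of (Phis s x) (gs s x)) /\
    (forall s, is_torsion (Phis s) (gs s) (Ts s)) /\
    (forall x, Phis 0 x = Phi) /\
    (forall x a b c d,
       is_derive (0 : R) (1 : R) (fun s => Phis s x a b c d) (phi x a b c d)) /\
    (forall x a b c,
       is_derive (0 : R) (1 : R) (fun s => Ts s x a b c) (t x a b c)).

Definition J2 (R : realType) (g : tensor2 R) (Phi : tensor4 R) (beta : tensor2 R)
    : tensor2 R :=
  \matrix_(i, j) (2^-1 * \sum_a \sum_b \sum_a' \sum_b'
    Phi i j a' b' * invmx g a' a * invmx g b' b * beta a b).

Definition J3 (R : realType) (g : tensor2 R) (Phi : tensor4 R) (gamma : tensor3 R)
    : tensor3 R := fun i j k =>
  3 / 2 * alt3 (fun i j k => \sum_p \sum_q \sum_p' \sum_q'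
    Phi i j p' q' * invmx g p' p * invmx g q' q * gamma k p q) i j k.

Definition in_Lambda27 (R : realType) (g : tensor2 R) (Phi : tensor4 R)
    (beta : tensor2 R) : Prop :=
  beta^T = - beta /\ J2 g Phi beta = - 3 *: beta.

(* S_{abc} T^{abc} *)
Definition dot3 (R : realType) (g : tensor2 R) (S T : tensor3 R) : R :=
  \sum_a \sum_b \sum_c \sum_a' \sum_b' \sum_c'
    invmx g a a' * invmx g b b' * invmx g c c' * S a b c * T a' b' c'.

(* The integrand of S_kappa against d^8x: for the orientation determined by
   Phi, v_Phi = sqrt(det g) d^8x. *)
Definition action_density (R : realType) (kappa : R) (g : tensor2 R)
    (Phi : tensor4 R) (T : tensor3 R) : R :=
  6^-1 * (((6 - 5 * kappa) * dot3 g T (J3 g Phi T) + 6 * kappa * dot3 g T T)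
          / (6 - (5 + kappa) * kappa)) * Num.sqrt (\det g).

(* From here on the metric is the flat background metric eta_ab = delta_ab
   and index positions are immaterial. *)

Definition perturbation (R : realType) (Phi : tensor4 R) (h xi : space R -> tensor2 R)
    (x : space R) : tensor4 R := fun a b c d =>
  - 4 * alt4 (fun a b c d =>
           \sum_p (h x a p + 4^-1 * xi x a p) * Phi b c d p) a b c d.

Definition L2 (R : realType) (kappa : R) (Phi : tensor4 R) (t : space R -> tensor3 R)
    (x : space R) : R :=
  action_density kappa 1%:M Phi (t x).

Section QuadraticTerms.
Variable R : realType.
Implicit Types (u v h xi : space R -> tensor2 R) (x : space R).

Definition d1 u (c a b : 'I_8) x : R := pd c (fun y => u y a b) x.

(* (\partial_c u_ab)^2 *)
Definition grad_sq u x : R := \sum_c \sum_a \sum_b d1 u c a b x ^+ 2.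
(* (\partial_a h)^2 *)
Definition grad_tr_sq h x : R := \sum_a pd a (fun y => \tr (h y)) x ^+ 2.
(* h \partial^a \partial^b h_ab *)
Definition tr_ddiv h x : R := \tr (h x) * \sum_a \sum_b pd a (d1 h b a b) x.
(* \partial^a u_ab *)
Definition div2 u (b : 'I_8) x : R := \sum_a d1 u a a b x.
(* (\partial^a u_ab) (\partial^c v_c^b) *)
Definition div_div u v x : R := \sum_b div2 u b x * div2 v b x.

Definition L_GR h x : R :=
  2^-1 * grad_sq h x - 2^-1 * grad_tr_sq h x - tr_ddiv h x - div_div h h x.

Definition L_prime h xi x : R :=
  2^-1 * grad_tr_sq h x + tr_ddiv h x + 2^-1 * div_div h h x
  + 16^-1 * grad_sq xi x - div_div h xi x.

End QuadraticTerms.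

(* A component of the pair (h, xi): xi_ij for (true, i, j), h_ij for
   (false, i, j). *)
Definition component (R : realType) (h xi : space R -> tensor2 R)
    (I : bool * 'I_8 * 'I_8) (x : space R) : R :=
  (if I.1.1 then xi x else h x) I.1.2 I.2.

(* The local vector current J^a = C^{a k I J} u_I \partial_k u_J, where u_I runs
   over the components of h and xi. *)
Definition current (R : realType)
    (C : 'I_8 -> 'I_8 -> bool * 'I_8 * 'I_8 -> bool * 'I_8 * 'I_8 -> R)
    (h xi : space R -> tensor2 R) (a : 'I_8) (x : space R) : R :=
  \sum_k \sum_I \sum_J
    C a k I J * component h xi I x * pd k (component h xi J) x.

(* Lagrangians as functionals of the perturbation (h, xi) and the torsion
   variation t it induces. *)
Notation lagrangian R :=
  ((space R -> tensor2 R) -> (space R -> tensor2 R) -> (space R -> tensor3 R) ->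
   space R -> R).

(* Equality modulo total derivatives for perturbations of the constant
   background Phi.  On R^8 every function is the divergence of some vector
   field, so the current has to be a fixed differential expression in the
   perturbation: its coefficients C are chosen before h, xi. *)
Definition eq_mod_total_derivatives (R : realType) (Phi : tensor4 R)
    (L L' : lagrangian R) : Prop :=
  exists C, forall (h xi : space R -> tensor2 R) (t : space R -> tensor3 R),
    (forall a b, smooth (fun x => h x a b)) ->
    (forall a b, smooth (fun x => xi x a b)) ->
    (forall x, (h x)^T = h x) ->
    (forall x, in_Lambda27 1%:M Phi (xi x)) ->
    torsion_variation Phi (perturbation Phi h xi) t ->
    forall x, L h xi t x = L' h xi t x + \sum_a pd a (current C h xi a) x.

(* Main.v *)
Require Import Defs.
From mathcomp Require Import all_boot all_order all_algebra all_fingroup.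
From mathcomp Require Import all_classical all_reals all_analysis.
From mathcomp Require Import ring lra.

Set Implicit Arguments.
Unset Strict Implicit.
Unset Printing Implicit Defensive.

Import Order.TTheory GRing.Theory Num.Theory.
Import numFieldNormedType.Exports.
Local Open Scope ring_scope.

(** Write [M.Phi] for the derivation action of a matrix [M] on [Phi].  Then
    [phi = (h + xi/4).Phi], and linearising the contracted Cayley identity gives
    [2 h] for the variation of the metric.  The symmetric part of the Christoffel
    symbols cancels in the linearised torsion equation, which becomes
    [(N_i - t_i).Phi = 0] with
    [N_iap = d_i xi_ap / 4 + d_p h_ai - d_a h_pi].  An antisymmetric matrix that
    annihilates [Phi] has no component in the 7-dimensional summand of the
    2-forms, so [A_i := 4 pi_7 (t_i)] equals [4 pi_7 (N_i)].  With
    [v_p := A_iip] one has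
    [A^2 = 4 t^2 - (4/3) t J_3 t] and [v^2 = (3/2) (t^2 - t J_3 t)], hence
    [36 c L2 = (3/8) (6 + kappa) A^2 - (6 - 3 kappa) v^2],
    and both squares are explicit in the first derivatives of [h] and [xi].
    For 2-forms [xi, zeta] in the 7-dimensional summand,
    [xi_ae zeta_ce + zeta_ae xi_ce = delta_ac xi.zeta / 4]; this turns
    [(div xi)^2] into [(d xi)^2 / 8] up to a divergence. *)

(** * Sums over permutations *)

(** The family behind [torsion_variation] is arbitrary, so neither its metric nor its torsion at
    [s = 0] is given; both must be shown to be the flat ones. For the metric, one quadratic
    expression in [Phi] is evaluated with the identity for [g] and with the identity for the flat
    metric. For the torsion, [A = 0] forces [t = 0]. Why [A] and [v] suffice: under Spin(7) the
    3-forms split into pieces of dimension 8 and 48, so there are two quadratic invariants, and the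
    formulas for [A^2] and [v^2] are linearly independent in [t^2] and [t J_3 t]. The factor 1/4 on
    [xi] in the perturbation makes [4 pi_7] return [d xi] itself. Differentiating the Christoffel
    symbols in [s] requires exchanging [d/ds] with [d_i], which is the symmetry of second
    derivatives on R x R^8. Since the current must be chosen before the fields, no integration by
    parts is done on given fields: each discarded term is an explicit combination, with constant
    coefficients, of divergences, mostly null Lagrangians [d_a u d_k w - d_k u d_a w]. *)

Lemma sum_perm_lift (R : pzRingType) n (G : 'S_n.+1 -> R) :
  \sum_(s : 'S_n.+1) (-1) ^+ s * G s =
  \sum_(k : 'I_n.+1) (-1) ^+ k * \sum_(s : 'S_n) (-1) ^+ s * G (lift_perm ord0 k s).
Proof.
rewrite (partition_big (fun s : 'S_n.+1 => s ord0) predT) //=.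
apply: eq_bigr => k _; rewrite big_distrr /=.
(* Inverse of [lift_perm]: delete [i] from the domain and [s i] from the range. The default [j] is
   never reached, since [s (lift i j)] differs from [s i]. *)
pose ulsf i (s : 'S_n.+1) j := odflt j (unlift (s i) (s (lift i j))).
have ulsfK i (s : 'S_n.+1) j : lift (s i) (ulsf i s j) = s (lift i j).
  by rewrite /ulsf; have:= neq_lift i j;
    rewrite -(can_eq (permK s)) => /unlift_some[] ? ? ->.
have inj_ulsf i (s : 'S_n.+1) : injective (ulsf i s).
  move=> j1 j2 eq_j; apply: (@lift_inj _ i); apply: (@perm_inj _ s).
  by rewrite -!ulsfK eq_j.
rewrite (reindex (lift_perm ord0 k)).
  apply: eq_big => [s|s _]; first by rewrite lift_perm_id eqxx.
  rewrite odd_lift_perm /= -(signr_odd _ k) mulrA; congr (_ * _).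
  by rewrite -signr_addb.
exists (fun s => perm (inj_ulsf ord0 s)) => [s _ | s].
  by apply/permP=> k'; rewrite permE /ulsf lift_perm_lift lift_perm_id liftK.
rewrite inE => /eqP si0; apply/permP=> k'.
case: (unliftP ord0 k') => [k''|] ->; rewrite ?lift_perm_id //.
by rewrite lift_perm_lift -si0 permE ulsfK.
Qed.

Lemma sum_perm0 (R : pzRingType) (G : 'S_0 -> R) :
  \sum_(s : 'S_0) (-1) ^+ s * G s = G 1%g.
Proof.
rewrite (big_pred1 1%g) => [|s]; first by rewrite odd_perm1 mul1r.
by apply/esym/eqP/permP => -[].
Qed.

Lemma sum_perm3 (R : realType) (G : 'I_3 -> 'I_3 -> 'I_3 -> R)
    (i0 := ord0) (i1 := lift ord0 ord0) (i2 := lift ord0 (lift ord0 ord0)) :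
  \sum_(s : 'S_3) (-1) ^+ s * G (s i0) (s i1) (s i2) =
  G i0 i1 i2 - G i0 i2 i1 - G i1 i0 i2 + G i1 i2 i0 + G i2 i0 i1 - G i2 i1 i0.
Proof.
rewrite sum_perm_lift; under eq_bigr do
  (rewrite sum_perm_lift; under eq_bigr do (rewrite sum_perm_lift;
   under eq_bigr do rewrite sum_perm0)).
rewrite !big_ord_recl !big_ord0 !(lift_perm_lift, lift_perm_id).
have -> : lift (lift ord0 ord0) ord0 = ord0 :> 'I_2 by exact: val_inj.
have E (x y : 'I_3) : val x = val y -> x = y := @val_inj _ _ _ x y.
rewrite (E (lift i1 ord0) i0) // (E (lift i1 (lift ord0 ord0)) i2) //.
rewrite (E (lift i2 ord0) i0) // (E (lift i2 (lift ord0 ord0)) i1) //.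
rewrite -/i0 -/i1 -/i2 /bump /=; ring.
Qed.

Lemma sum_perm4 (R : realType) (G : 'I_4 -> 'I_4 -> 'I_4 -> 'I_4 -> R)
    (i0 := ord0) (i1 := lift ord0 ord0) (i2 := lift ord0 (lift ord0 ord0))
    (i3 := lift ord0 (lift ord0 (lift ord0 ord0))) :
  \sum_(s : 'S_4) (-1) ^+ s * G (s i0) (s i1) (s i2) (s i3) =
  \sum_(k : 'I_4) (-1) ^+ k * (let l := lift k in
    let j0 := l ord0 in let j1 := l (lift ord0 ord0) in
    let j2 := l (lift ord0 (lift ord0 ord0)) in
    G k j0 j1 j2 - G k j0 j2 j1 - G k j1 j0 j2 + G k j1 j2 j0
    + G k j2 j0 j1 - G k j2 j1 j0).
Proof.
rewrite sum_perm_lift; apply: eq_bigr => k _.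
under eq_bigr do rewrite lift_perm_id !lift_perm_lift.
by rewrite (sum_perm3 (fun a b c => G k (lift k a) (lift k b) (lift k c))).
Qed.

Lemma alt3E (R : realType) (X : tensor3 R) a b c :
  alt3 X a b c =
  6^-1 * (X a b c - X a c b - X b a c + X b c a + X c a b - X c b a).
Proof.
have i0 : inord 0 = ord0 :> 'I_3 by apply: val_inj; rewrite /= inordK.
have i1 : inord 1 = lift ord0 ord0 :> 'I_3 by apply: val_inj; rewrite /= inordK.
have i2 : inord 2 = lift ord0 (lift ord0 ord0) :> 'I_3.
  by apply: val_inj; rewrite /= inordK.
rewrite /alt3 i0 i1 i2; set v := tnth _.
rewrite (sum_perm3 (fun i j k => X (v i) (v j) (v k))).
by rewrite /v !(tnth_nth a) /=.
Qed.

Lemma alt4E (R : realType) (X : tensor4 R) a b c d :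
  alt4 X a b c d = 24^-1 *
  (X a b c d - X a b d c - X a c b d + X a c d b + X a d b c - X a d c b
   - X b a c d + X b a d c + X b c a d - X b c d a - X b d a c + X b d c a
   + X c a b d - X c a d b - X c b a d + X c b d a + X c d a b - X c d b a
   - X d a b c + X d a c b + X d b a c - X d b c a - X d c a b + X d c b a).
Proof.
have i0 : inord 0 = ord0 :> 'I_4 by apply: val_inj; rewrite /= inordK.
have i1 : inord 1 = lift ord0 ord0 :> 'I_4 by apply: val_inj; rewrite /= inordK.
have i2 : inord 2 = lift ord0 (lift ord0 ord0) :> 'I_4.
  by apply: val_inj; rewrite /= inordK.
have i3 : inord 3 = lift ord0 (lift ord0 (lift ord0 ord0)) :> 'I_4.
  by apply: val_inj; rewrite /= inordK.
rewrite /alt4 i0 i1 i2 i3; set v := tnth _.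
rewrite (sum_perm4 (fun i j k l => X (v i) (v j) (v k) (v l))).
rewrite !big_ord_recl big_ord0 /v !(tnth_nth a) /=.
rewrite /bump /= !(addn0, add1n, add0n) /=; ring.
Qed.

(** * Sums over two and four indices *)

Section Sums.
Variable R : realType.
Implicit Types F G : 'I_8 -> 'I_8 -> 'I_8 -> 'I_8 -> R.

Lemma sum_mx1l (f : 'I_8 -> R) i : \sum_j (1%:M : 'M[R]_8) i j * f j = f i.
Proof.
rewrite (bigD1 i) //= mxE eqxx mul1r big1 ?addr0 // => j ne.
by rewrite mxE eq_sym (negPf ne) mul0r.
Qed.

Lemma sum_mx1r (f : 'I_8 -> R) i : \sum_j (1%:M : 'M[R]_8) j i * f j = f i.
Proof. by rewrite -[RHS]sum_mx1l; apply: eq_bigr => j _; rewrite !mxE eq_sym. Qed.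

Lemma sum_mx1C (f : 'I_8 -> R) i : \sum_j f j * (1%:M : 'M[R]_8) i j = f i.
Proof. by under eq_bigr do rewrite mulrC; rewrite sum_mx1l. Qed.

Lemma sum_mx1rC (f : 'I_8 -> R) i : \sum_j f j * (1%:M : 'M[R]_8) j i = f i.
Proof. by under eq_bigr do rewrite mulrC; rewrite sum_mx1r. Qed.

Lemma eqN_eq0 (x : R) : x = - x -> x = 0.
Proof. lra. Qed.

Lemma sum2_anti0 (F : 'I_8 -> 'I_8 -> R) :
  (forall j k, F k j = - F j k) -> \sum_j \sum_k F j k = 0.
Proof.
move=> FN; apply: eqN_eq0; rewrite {1}exchange_big -sumrN.
by apply: eq_bigr => j _; rewrite -sumrN; apply: eq_bigr => k _.
Qed.

(** A named fourfold sum, so that renaming bound indices becomes a rewrite by adjacent swaps, which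
    generate all permutations of the four indices. *)
Definition sum4 F := \sum_j \sum_k \sum_b \sum_c F j k b c.

Lemma eq_sum4 F G : (forall j k b c, F j k b c = G j k b c) -> sum4 F = sum4 G.
Proof.
move=> FG; apply: eq_bigr => j _; apply: eq_bigr => k _.
by apply: eq_bigr => b _; apply: eq_bigr => c _.
Qed.

Lemma sum4D F G :
  sum4 (fun j k b c => F j k b c + G j k b c) = sum4 F + sum4 G.
Proof.
rewrite /sum4; do 3![rewrite -big_split; apply: eq_bigr => ? _ /=].
by rewrite -big_split.
Qed.

Lemma sum4N F : sum4 (fun j k b c => - F j k b c) = - sum4 F.
Proof.
rewrite /sum4; do 3![rewrite -sumrN; apply: eq_bigr => ? _ /=].
by rewrite -sumrN.
Qed.

Lemma sum4B F G :
  sum4 (fun j k b c => F j k b c - G j k b c) = sum4 F - sum4 G.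
Proof. by rewrite sum4D sum4N. Qed.

Lemma sum4Z x F : sum4 (fun j k b c => x * F j k b c) = x * sum4 F.
Proof.
by rewrite /sum4; do 4![rewrite mulr_sumr; apply: eq_bigr => ? _ /=].
Qed.

Lemma sum4_12 F : sum4 F = sum4 (fun j k b c => F k j b c).
Proof. by rewrite /sum4 exchange_big. Qed.

Lemma sum4_23 F : sum4 F = sum4 (fun j k b c => F j b k c).
Proof. by apply: eq_bigr => j _; rewrite exchange_big. Qed.

Lemma sum4_34 F : sum4 F = sum4 (fun j k b c => F j k c b).
Proof. by apply: eq_bigr => j _; apply: eq_bigr => k _; rewrite exchange_big. Qed.

Lemma sum4_13 F : sum4 F = sum4 (fun j k b c => F b k j c).
Proof. by rewrite sum4_12 sum4_23 sum4_12. Qed.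

Lemma sum4_24 F : sum4 F = sum4 (fun j k b c => F j c b k).
Proof. by rewrite sum4_23 sum4_34 sum4_23. Qed.

Lemma sum4_14_23 F : sum4 F = sum4 (fun j k b c => F c b k j).
Proof. by rewrite sum4_34 sum4_23 sum4_12 sum4_34 sum4_23 sum4_34. Qed.

Lemma sum4_anti13 F :
  (forall j k b c, F b k j c = - F j k b c) -> sum4 F = 0.
Proof. by move=> FN; apply: eqN_eq0; rewrite {1}sum4_13 -sum4N; apply: eq_sum4. Qed.

Lemma sum4_anti24 F :
  (forall j k b c, F j c b k = - F j k b c) -> sum4 F = 0.
Proof. by move=> FN; apply: eqN_eq0; rewrite {1}sum4_24 -sum4N; apply: eq_sum4. Qed.

Lemma sum4_anti_rev F :
  (forall j k b c, F c b k j = - F j k b c) -> sum4 F = 0.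
Proof.
by move=> FN; apply: eqN_eq0; rewrite {1}sum4_14_23 -sum4N; apply: eq_sum4.
Qed.

Lemma sum4_mx1 F :
  sum4 (fun j k b c => (1%:M : 'M[R]_8) j b * (1%:M : 'M[R]_8) k c * F j k b c) =
  \sum_j \sum_k F j k j k.
Proof.
apply: eq_bigr => j _; apply: eq_bigr => k _.
under eq_bigr do (under eq_bigr do rewrite mulrAC mulrC; rewrite sum_mx1l).
by rewrite sum_mx1l.
Qed.

Lemma mulmx3E (A B C : 'M[R]_8) i a :
  (A *m B *m C) i a = \sum_j \sum_k A i j * B j k * C k a.
Proof.
by rewrite mxE exchange_big; apply: eq_bigr => k _; rewrite mxE mulr_suml.
Qed.

End Sums.

(** * Total antisymmetry of Cayley forms *)

Definition is_form4 (R : realType) (X : tensor4 R) : Prop :=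
  forall a b c d,
    [/\ X b a c d = - X a b c d, X a c b d = - X a b c d
      & X a b d c = - X a b c d].

Section Form4.
Variables (R : realType) (X : tensor4 R) (fX : is_form4 X).

Lemma form4_12 a b c d : X b a c d = - X a b c d. Proof. by have [] := fX a b c d. Qed.
Lemma form4_23 a b c d : X a c b d = - X a b c d. Proof. by have [] := fX a b c d. Qed.
Lemma form4_34 a b c d : X a b d c = - X a b c d. Proof. by have [] := fX a b c d. Qed.
Lemma form4_13 a b c d : X c b a d = - X a b c d.
Proof. by rewrite form4_12 form4_23 form4_12 !opprK. Qed.
Lemma form4_24 a b c d : X a d c b = - X a b c d.
Proof. by rewrite form4_23 form4_34 form4_23 !opprK. Qed.
Lemma form4_14 a b c d : X d b c a = - X a b c d.
Proof. by rewrite form4_12 form4_24 form4_12 !opprK. Qed.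
Lemma form4_z24 a b c : X a b c b = 0. Proof. exact/eqN_eq0/form4_24. Qed.

End Form4.

(** Exchanging two arguments exchanges two columns of the defining determinant. *)
Lemma wedge4_form (R : realType) I : is_form4 (@wedge4 R I).
Proof.
have swap (f g : 'I_4 -> 'I_8) (i j : 'I_4) : i != j ->
    (forall n, g n = f (tperm i j n)) ->
    \det (\matrix_(m < 4, n < 4) (nth 0%N I m == g n :> nat)%:R : 'M[R]_4) =
  - \det (\matrix_(m < 4, n < 4) (nth 0%N I m == f n :> nat)%:R : 'M[R]_4).
  move=> ij gf; set A := (X in _ = - \det X).
  rewrite [X in \det X = _](_ : _ = A *m perm_mx (tperm i j)); last first.
    by rewrite -[tperm i j]tpermV -col_permE; apply/matrixP => m n; rewrite !mxE gf.
  by rewrite det_mulmx det_perm odd_tperm ij /= expr1 mulrN1.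
have dec : forall n : 'I_4, [\/ n = inord 0, n = inord 1, n = inord 2 | n = inord 3].
  case=> -[|[|[|[|//]]]] ?; [constructor 1|constructor 2|constructor 3|constructor 4];
  by apply: val_inj; rewrite /= inordK.
move=> a b c d; split.
- apply: (swap _ _ (inord 0) (inord 1)); first by rewrite -val_eqE /= !inordK.
  move=> n; rewrite permE /=.
  by case: (dec n) => ->; rewrite !(tnth_nth a) -?val_eqE /= !inordK.
- apply: (swap _ _ (inord 1) (inord 2)); first by rewrite -val_eqE /= !inordK.
  move=> n; rewrite permE /=.
  by case: (dec n) => ->; rewrite !(tnth_nth a) -?val_eqE /= !inordK.
- apply: (swap _ _ (inord 2) (inord 3)); first by rewrite -val_eqE /= !inordK.
  move=> n; rewrite permE /=.
  by case: (dec n) => ->; rewrite !(tnth_nth a) -?val_eqE /= !inordK.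
Qed.

Lemma cayley0_form (R : realType) : is_form4 (@cayley0 R).
Proof.
by move=> a b c d; split; rewrite /cayley0 opprB addrC -!sumrN;
  congr (_ + _); rewrite -?sumrN; apply: eq_bigr => I _;
  have [E1 E2 E3] := wedge4_form R I a b c d; rewrite ?E1 ?E2 ?E3 ?opprK.
Qed.

Lemma cayley_form_is_form4 (R : realType) (Phi : tensor4 R) :
  cayley_form Phi -> is_form4 Phi.
Proof.
case=> A _ PhiE a b c d; rewrite !PhiE; split.
- rewrite exchange_big -sumrN; apply: eq_bigr => i _.
  rewrite -sumrN; apply: eq_bigr => j _; rewrite -sumrN; apply: eq_bigr => k _.
  rewrite -sumrN; apply: eq_bigr => l _.
  have [-> _ _] := cayley0_form R i j k l; ring.
- rewrite -sumrN; apply: eq_bigr => i _; rewrite exchange_big -sumrN.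
  apply: eq_bigr => j _; rewrite -sumrN; apply: eq_bigr => k _.
  rewrite -sumrN; apply: eq_bigr => l _.
  have [_ -> _] := cayley0_form R i j k l; ring.
- rewrite -sumrN; apply: eq_bigr => i _; rewrite -sumrN; apply: eq_bigr => j _.
  rewrite exchange_big -sumrN; apply: eq_bigr => k _.
  rewrite -sumrN; apply: eq_bigr => l _.
  have [_ _ ->] := cayley0_form R i j k l; ring.
Qed.

(** * Contractions of the Cayley identity *)

Section CayleyContractions.
Variables (R : realType) (g : 'M[R]_8) (Phi : tensor4 R).
Hypotheses (gT : g^T = g) (fPhi : is_form4 Phi) (cid : cayley_identity g Phi).

Let gC i j : g i j = g j i. Proof. by rewrite -{1}gT mxE. Qed.

Let f12 := form4_12 fPhi.
Let f23 := form4_23 fPhi.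
Let f34 := form4_34 fPhi.
Let f13 := form4_13 fPhi.
Let f24 := form4_24 fPhi.

(** Each of the nine terms [g * Phi] is odd under a relabelling that preserves [S j b * S k c]:
    [j <-> b], [k <-> c], or the reversal [j <-> c], [k <-> b]. The matrix [S] need not be related
    to [g]; this freedom is what allows two metrics to be compared. *)
Lemma cayley_contr_sym (S : 'M[R]_8) i a : S^T = S ->
  sum4 (fun j k b c => S j b * S k c *
    \sum_p \sum_q Phi i j k p * invmx g p q * Phi a b c q) =
  sum4 (fun j k b c => S j b * S k c *
    (g i a * g j b * g k c + g i b * g j c * g k a + g i c * g j a * g k b
    - g i a * g j c * g k b - g i c * g j b * g k a - g i b * g j a * g k c)).
Proof.
move=> ST; have SC x y : S x y = S y x by rewrite -{1}ST mxE.
rewrite (@eq_sum4 _ _ (fun j k b c => S j b * S k c *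
    (g i a * g j b * g k c + g i b * g j c * g k a + g i c * g j a * g k b
    - g i a * g j c * g k b - g i c * g j b * g k a - g i b * g j a * g k c)
    - S j b * S k c * (g i a * Phi j k b c)
    - S j b * S k c * (g j a * Phi k i b c)
    - S j b * S k c * (g k a * Phi i j b c)
    - S j b * S k c * (g i b * Phi j k c a)
    - S j b * S k c * (g j b * Phi k i c a)
    - S j b * S k c * (g k b * Phi i j c a)
    - S j b * S k c * (g i c * Phi j k a b)
    - S j b * S k c * (g j c * Phi k i a b)
    - S j b * S k c * (g k c * Phi i j a b))); last by move=> j k b c; rewrite cid; ring.
rewrite 9!sum4B /=.
rewrite (@sum4_anti13 _ (fun j k b c => S j b * S k c * (g i a * Phi j k b c))); last first.
  by move=> j k b c; rewrite (SC b) (f13 j); ring.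
rewrite (@sum4_anti24 _ (fun j k b c => S j b * S k c * (g j a * Phi k i b c))); last first.
  by move=> j k b c; rewrite (SC c) (form4_14 fPhi k); ring.
rewrite (@sum4_anti13 _ (fun j k b c => S j b * S k c * (g k a * Phi i j b c))); last first.
  by move=> j k b c; rewrite (SC b) (f23 i); ring.
rewrite (@sum4_anti24 _ (fun j k b c => S j b * S k c * (g i b * Phi j k c a))); last first.
  by move=> j k b c; rewrite (SC c) (f23 j); ring.
rewrite (@sum4_anti24 _ (fun j k b c => S j b * S k c * (g j b * Phi k i c a))); last first.
  by move=> j k b c; rewrite (SC c) (f13 k); ring.
rewrite (@sum4_anti_rev _ (fun j k b c => S j b * S k c * (g k b * Phi i j c a))); last first.
  by move=> j k b c; rewrite (SC c) (SC b) (gC b) (f23 i); ring.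
rewrite (@sum4_anti13 _ (fun j k b c => S j b * S k c * (g i c * Phi j k a b))); last first.
  by move=> j k b c; rewrite (SC b) (form4_14 fPhi j); ring.
rewrite (@sum4_anti_rev _ (fun j k b c => S j b * S k c * (g j c * Phi k i a b))); last first.
  by move=> j k b c; rewrite (SC c) (SC b) (gC c) (form4_14 fPhi k); ring.
rewrite (@sum4_anti13 _ (fun j k b c => S j b * S k c * (g k c * Phi i j a b))); last first.
  by move=> j k b c; rewrite (SC b) (f24 i); ring.
by rewrite !subr0.
Qed.

(** Contracting two index pairs with the identity matrix instead of the inverse of [g] leaves a
    polynomial in [g] on the right. It serves both to compare [g] with the flat metric and to
    differentiate in [g]. *)
Lemma cayley_contr_delta i a :
  \sum_j \sum_k \sum_p \sum_q Phi i j k p * invmx g p q * Phi a j k q =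
  ((\tr g) ^+ 2 - \tr (g *m g)) * g i a - 2 * \tr g * (g *m g) i a
  + 2 * (g *m g *m g) i a.
Proof.
have := @cayley_contr_sym 1%:M i a (trmx1 _ _).
rewrite !sum4_mx1 => ->.
have E1 : \sum_j \sum_k g j j * g k k = (\tr g) ^+ 2.
  by rewrite expr2 mulr_suml; apply: eq_bigr => j _; rewrite mulr_sumr.
have E2 : \sum_j \sum_k g j k * g k j = \tr (g *m g).
  by apply: eq_bigr => j _; rewrite mxE.
have E3 : \sum_j \sum_k g i j * g j k * g k a = (g *m g *m g) i a.
  by rewrite mulmx3E.
have E3' : \sum_j \sum_k g i k * g j a * g k j = (g *m g *m g) i a.
  by rewrite -E3 exchange_big; do 2!apply: eq_bigr => ? _; rewrite mulrAC.
have E4 : \sum_j \sum_k g i k * g j j * g k a = \tr g * (g *m g) i a.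
  rewrite mulr_suml; apply: eq_bigr => j _; rewrite mxE mulr_sumr.
  by apply: eq_bigr => k _; ring.
have E4' : \sum_j \sum_k g i j * g j a * g k k = \tr g * (g *m g) i a.
  by rewrite -E4 exchange_big; do 2!apply: eq_bigr => ? _; ring.
transitivity (g i a * (\sum_j \sum_k g j j * g k k)
  + \sum_j \sum_k g i j * g j k * g k a + \sum_j \sum_k g i k * g j a * g k j
  - g i a * (\sum_j \sum_k g j k * g k j)
  - \sum_j \sum_k g i k * g j j * g k a
  - \sum_j \sum_k g i j * g j a * g k k); last first.
  by rewrite E1 E2 E3 E3' E4 E4'; ring.
rewrite !mulr_sumr -!sumrN -!big_split /=; apply: eq_bigr => j _.
rewrite !mulr_sumr -!sumrN -!big_split /=; apply: eq_bigr => k _; ring.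
Qed.

(** The trace [g_kc g^kc = 8] multiplies both kinds of terms. Two metric terms of each sign reduce 8
    to 6, and four of the terms linear in [Phi] turn -8 into -4; the remaining four vanish by
    antisymmetry. *)
Lemma cayley_contr2 i j a b : g \in unitmx ->
  \sum_k \sum_c invmx g k c *
    (\sum_p \sum_q Phi i j k p * invmx g p q * Phi a b c q) =
  6 * (g i a * g j b - g i b * g j a) - 4 * Phi i j a b.
Proof.
move=> ug; have KC x y : invmx g x y = invmx g y x.
  by rewrite -[in LHS]gT -trmx_inv mxE.
set K := invmx g in KC *.
have Kg x y : \sum_z K x z * g z y = (1%:M : 'M[R]_8) x y.
  by rewrite -(mulVmx ug) mxE.
have gK x y : \sum_z g x z * K z y = (1%:M : 'M[R]_8) x y.
  by rewrite -(mulmxV ug) mxE.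
have K1 (F : 'I_8 -> R) z : \sum_k \sum_c K k c * (g k z * F c) = F z.
  rewrite exchange_big -[RHS]sum_mx1r; apply: eq_bigr => c _.
  by rewrite -Kg mulr_suml; apply: eq_bigr => k _; rewrite KC mulrA.
have K2 (F : 'I_8 -> R) z : \sum_k \sum_c K k c * (g z c * F k) = F z.
  rewrite exchange_big -[RHS](K1 F); apply: eq_bigr => k _.
  by apply: eq_bigr => c _; rewrite KC gC.
have K3 : \sum_k \sum_c K k c * g k c = 8.
  transitivity (\tr (1%:M : 'M[R]_8)); last by rewrite mxtrace1.
  by apply: eq_bigr => k _; rewrite -gK; apply: eq_bigr => c _; rewrite KC mulrC gC.
transitivity (
    (g i a * g j b - g i b * g j a - Phi i j a b) * (\sum_k \sum_c K k c * g k c)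
  + g i b * (\sum_k \sum_c K k c * (g k a * g j c))
  + g j a * (\sum_k \sum_c K k c * (g k b * g i c))
  - g i a * (\sum_k \sum_c K k c * (g k b * g j c))
  - g j b * (\sum_k \sum_c K k c * (g k a * g i c))
  - \sum_k \sum_c K k c * (g k a * Phi i j b c)
  - \sum_k \sum_c K k c * (g k b * Phi i j c a)
  - \sum_k \sum_c K k c * (g i c * Phi j k a b)
  - \sum_k \sum_c K k c * (g j c * Phi k i a b)
  - g i a * (\sum_k \sum_c K k c * Phi j k b c)
  - g j a * (\sum_k \sum_c K k c * Phi k i b c)
  - g i b * (\sum_k \sum_c K k c * Phi j k c a)
  - g j b * (\sum_k \sum_c K k c * Phi k i c a)).
  rewrite !mulr_sumr -!sumrN -!big_split /=; apply: eq_bigr => k _.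
  rewrite !mulr_sumr -!sumrN -!big_split /=; apply: eq_bigr => c _.
  rewrite cid; ring.
rewrite !K1 !K2 K3 !sum2_anti0; first last.
- by move=> k c; rewrite KC (f24 j); ring.
- by move=> k c; rewrite KC (form4_14 fPhi k); ring.
- by move=> k c; rewrite KC (f23 j); ring.
- by move=> k c; rewrite KC (f13 k); ring.
rewrite (f34 i j a b) (f12 i j a b); ring.
Qed.

End CayleyContractions.

Section FlatContractions.
Variables (R : realType) (Phi : tensor4 R).
Hypotheses (fPhi : is_form4 Phi) (cid : cayley_identity 1%:M Phi).

Local Notation eta := (1%:M : 'M[R]_8).

Lemma etaC i j : eta i j = eta j i.
Proof. by rewrite !mxE eq_sym. Qed.

Lemma sum_invmx1 (F G : 'I_8 -> R) :
  \sum_p \sum_q F p * invmx eta p q * G q = \sum_p F p * G p.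
Proof.
rewrite invmx1; apply: eq_bigr => p _.
by under eq_bigr do rewrite mulrAC; rewrite sum_mx1C.
Qed.

Lemma flat_contr1 i j k a b c :
  \sum_p Phi i j k p * Phi a b c p =
      eta i a * eta j b * eta k c + eta i b * eta j c * eta k a
    + eta i c * eta j a * eta k b - eta i a * eta j c * eta k b
    - eta i c * eta j b * eta k a - eta i b * eta j a * eta k c
    - eta i a * Phi j k b c - eta j a * Phi k i b c - eta k a * Phi i j b c
    - eta i b * Phi j k c a - eta j b * Phi k i c a - eta k b * Phi i j c a
    - eta i c * Phi j k a b - eta j c * Phi k i a b - eta k c * Phi i j a b.
Proof. by rewrite -sum_invmx1; exact: cid. Qed.

Lemma flat_contr2 i j a b :
  \sum_k \sum_p Phi i j k p * Phi a b k p =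
  6 * (eta i a * eta j b - eta i b * eta j a) - 4 * Phi i j a b.
Proof.
rewrite -(cayley_contr2 (trmx1 _ _) fPhi cid) ?unitmx1 //.
apply: eq_bigr => k _; rewrite invmx1 sum_mx1l.
by rewrite -[LHS]sum_invmx1 invmx1.
Qed.

Lemma flat_contr3 i a :
  \sum_j \sum_k \sum_p Phi i j k p * Phi a j k p = 42 * eta i a.
Proof.
have -> : 42 * eta i a = \sum_j (6 * (eta j j * eta i a - eta i j * eta j a)).
  rewrite -mulr_sumr sumrB -mulr_suml sum_mx1l -/(\tr eta) mxtrace1; ring.
apply: eq_bigr => j _; rewrite flat_contr2 (form4_z24 fPhi); ring.
Qed.

(** The double contraction [flat_contr2] is weighted with [S]; its term linear in [Phi] is
    antisymmetric in the weighted pair and drops out. *)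
Lemma flat_contr_sym (S : 'M[R]_8) i a : S^T = S ->
  \sum_j \sum_k \sum_p \sum_q Phi i j k p * S p q * Phi a j k q =
  6 * (\tr S * eta i a - S i a).
Proof.
move=> ST; have SC x y : S x y = S y x by rewrite -{1}ST mxE.
symmetry.
transitivity (sum4 (fun p q j k => S p q * (Phi i p j k * Phi a q j k))).
  transitivity (\sum_p \sum_q (6 * (eta i a * (eta p q * S p q)
      - eta i q * (eta p a * S p q)) - 4 * (S p q * Phi i p a q))); last first.
    apply: eq_bigr => p _; apply: eq_bigr => q _.
    transitivity (S p q * \sum_j \sum_k Phi i p j k * Phi a q j k).
      by rewrite flat_contr2; ring.
    by rewrite mulr_sumr; apply: eq_bigr => j _; rewrite mulr_sumr.
  transitivity (6 * (eta i a * (\sum_p \sum_q eta p q * S p q)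
      - \sum_p \sum_q eta i q * (eta p a * S p q))
    - 4 * \sum_p \sum_q S p q * Phi i p a q).
    rewrite (@sum2_anti0 _ (fun p q => S p q * _)); last first.
      by move=> p q; rewrite SC (form4_24 fPhi); ring.
    have -> : \sum_p \sum_q eta p q * S p q = \tr S.
      by apply: eq_bigr => p _; rewrite sum_mx1l.
    have -> : \sum_p \sum_q eta i q * (eta p a * S p q) = S a i.
      by under eq_bigr do rewrite sum_mx1l; rewrite sum_mx1r.
    by rewrite (SC i a); ring.
  rewrite mulrBr !mulr_sumr -!sumrN -!big_split /=; apply: eq_bigr => p _.
  rewrite !mulr_sumr -!sumrN -!big_split /=; apply: eq_bigr => q _; ring.
rewrite sum4_23 sum4_12 sum4_34 sum4_23; apply: eq_sum4 => j k p q.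
by rewrite (form4_23 fPhi i j p k) (form4_34 fPhi i j k p)
  (form4_23 fPhi a j q k) (form4_34 fPhi a j k q); ring.
Qed.

End FlatContractions.

(** * A Cayley form that satisfies the flat identity has only the flat metric *)

Section MetricUniqueness.
Variables (R : realType) (Phi : tensor4 R) (g : 'M[R]_8).
Hypotheses (fPhi : is_form4 Phi).
Hypotheses (cid1 : cayley_identity 1%:M Phi) (cid : cayley_identity g Phi).
Hypotheses (gT : g^T = g) (ug : g \in unitmx).
Local Notation K := (invmx g).
Local Notation eta := (1%:M : 'M[R]_8).

Let KT : K^T = K. Proof. by rewrite trmx_inv gT. Qed.
Let KC i j : K i j = K j i. Proof. by rewrite -[in LHS]KT mxE. Qed.

(** Both sides evaluate [Phi_ijkp K_pq Phi_ajkq]: the left by the flat identity with weight [K], the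
    right by the identity for [g], where [K] is the inverse metric. *)
Lemma metric_eqn1 :
  6 *: ((\tr K)%:M - K) =
  ((\tr g) ^+ 2 - \tr (g *m g)) *: g - (2 * \tr g) *: (g *m g)
  + 2 *: (g *m g *m g).
Proof.
apply/matrixP => i a.
transitivity (\sum_j \sum_k \sum_p \sum_q Phi i j k p * K p q * Phi a j k q);
  last by rewrite (cayley_contr_delta gT fPhi cid) !mxE.
by rewrite (flat_contr_sym fPhi cid1 _ _ KT) !mxE; ring.
Qed.

(** Both sides evaluate [K_jb K_kc Phi_ijkp Phi_abcp]: the left by the identity for [g] with two
    inverse metrics contracted, the right by the flat identity with weight [K]. It mirrors
    [metric_eqn1] with [g] and [K] exchanged. *)
Lemma metric_eqn2 :
  6 *: (\tr g *: g - g *m g) =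
  ((\tr K) ^+ 2 - \tr (K *m K))%:M - (2 * \tr K) *: K + 2 *: (K *m K).
Proof.
apply/matrixP => i a.
transitivity (sum4 (fun j k b c => K j b * K k c *
  \sum_p \sum_q Phi i j k p * invmx eta p q * Phi a b c q)).
  transitivity (\sum_p (6 * (g i a * g p p - g i p * g p a))).
    rewrite -mulr_sumr sumrB -mulr_sumr -/(\tr g) !mxE; ring.
  transitivity (\sum_p \sum_k \sum_c K k c *
     (\sum_j \sum_b Phi i p k j * K j b * Phi a p c b)).
    apply: eq_bigr => p _; rewrite (cayley_contr2 gT fPhi cid _ _ _ _ ug).
    by rewrite (form4_z24 fPhi); ring.
  transitivity (\sum_p sum4 (fun k c j b =>
     K k c * K j b * (Phi i j k p * Phi a b c p))).
    apply: eq_bigr => p _; apply: eq_bigr => k _; apply: eq_bigr => c _.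
    rewrite mulr_sumr; apply: eq_bigr => j _.
    rewrite mulr_sumr; apply: eq_bigr => b _.
    by rewrite (form4_24 fPhi i j k p) (form4_24 fPhi a b c p); ring.
  transitivity (\sum_p sum4 (fun j k b c =>
     K j b * K k c * (Phi i j k p * Phi a b c p))).
    apply: eq_bigr => p _; rewrite sum4_23 sum4_12 sum4_34.
    apply: eq_sum4 => j k b c; ring.
  rewrite /sum4 exchange_big; apply: eq_bigr => j _.
  rewrite exchange_big; apply: eq_bigr => k _.
  rewrite exchange_big; apply: eq_bigr => b _.
  rewrite exchange_big; apply: eq_bigr => c _.
  by rewrite sum_invmx1 mulr_sumr.
rewrite (cayley_contr_sym (trmx1 _ _) fPhi cid1 _ _ KT).
have E1 : sum4 (fun j k b c => eta j b * (eta k c * (K j b * K k c))) = (\tr K) ^+ 2.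
  transitivity (\sum_j \sum_k K j j * K k k).
    apply: eq_bigr => j _; apply: eq_bigr => k _.
    by under eq_bigr do (rewrite -mulr_sumr sum_mx1l); rewrite sum_mx1l.
  by rewrite expr2 mulr_suml; apply: eq_bigr => j _; rewrite mulr_sumr.
have E2 : sum4 (fun j k b c => eta j c * (eta k b * (K j b * K k c))) =
    \tr (K *m K).
  transitivity (\sum_j \sum_k K j k * K k j).
    apply: eq_bigr => j _; apply: eq_bigr => k _.
    by under eq_bigr do rewrite sum_mx1l; rewrite sum_mx1l.
  by apply: eq_bigr => j _; rewrite mxE.
have E3 : sum4 (fun j k b c => eta k a * (eta i b * (eta j c * (K j b * K k c))))
    = (K *m K) i a.
  rewrite mxE; apply: eq_bigr => j _.
  under eq_bigr do (under eq_bigr do rewrite -!mulr_sumr sum_mx1l;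
    rewrite -mulr_sumr sum_mx1l).
  by rewrite sum_mx1r [K a j]KC [K j i]KC mulrC.
have E4 : sum4 (fun j k b c => eta k b * (eta i c * (eta j a * (K j b * K k c))))
    = (K *m K) i a.
  rewrite mxE sum4_12; apply: eq_bigr => j _.
  under eq_bigr do (under eq_bigr do (rewrite -mulr_sumr sum_mx1l);
    rewrite sum_mx1l).
  by rewrite sum_mx1r [K a j]KC [K j i]KC mulrC.
have E5 : sum4 (fun j k b c => eta j b * (eta i c * (eta k a * (K j b * K k c))))
    = \tr K * K i a.
  rewrite mulr_suml; apply: eq_bigr => j _.
  under eq_bigr do (under eq_bigr do (rewrite -mulr_sumr sum_mx1l); rewrite sum_mx1l).
  by rewrite sum_mx1r KC.
have E6 : sum4 (fun j k b c => eta k c * (eta i b * (eta j a * (K j b * K k c))))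
    = \tr K * K i a.
  rewrite mulr_suml sum4_12; apply: eq_bigr => j _.
  under eq_bigr do (under eq_bigr do rewrite sum_mx1l; rewrite sum_mx1l).
  by rewrite sum_mx1r KC mulrC.
transitivity (eta i a * (\tr K) ^+ 2 + (K *m K) i a + (K *m K) i a
  - eta i a * \tr (K *m K) - \tr K * K i a - \tr K * K i a); last first.
  by rewrite !mxE; ring.
rewrite -E1 -E2 -{1}E3 -E4 -{1}E5 -E6 -!sum4Z -!sum4D -!sum4B.
apply: eq_sum4 => j k b c; ring.
Qed.


End MetricUniqueness.

Section MetricUniqueness.
Variables (R : realType) (Phi : tensor4 R) (g : 'M[R]_8).
Hypotheses (fPhi : is_form4 Phi).
Hypotheses (cid1 : cayley_identity 1%:M Phi) (cid : cayley_identity g Phi).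
Hypotheses (gT : g^T = g) (ug : g \in unitmx).
Local Notation K := (invmx g).
Local Notation eta := (1%:M : 'M[R]_8).

Let KT : K^T = K. Proof. by rewrite trmx_inv gT. Qed.
Let KC i j : K i j = K j i. Proof. by rewrite -[in LHS]KT mxE. Qed.

(* With [a] as below, eliminating cubic and quadratic terms from the two
   contracted identities leaves [a g = 8 (tr K - K)] and [a K = 8 (tr g - g)];
   hence [g] is scalar unless [a^2 = 64], and then the traces force [tr g = 0]. *)
Lemma metric_uniqueness : 0 < \tr g -> g = 1%:M.
Proof.
have [gK Kg] := (mulmxV ug, mulVmx ug).
set p := \tr g; set k := \tr K => p_gt0.
have [e1 e2] := (metric_eqn1 fPhi cid1 cid gT, metric_eqn2 fPhi cid1 cid gT ug); rewrite -/p -/k in e1 e2.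
set a := p ^+ 2 - \tr (g *m g) in e1.
(* The trace of [e2] has coefficients 8 - 2 = 6 on the side of [K] and 6 on the side of [g], so both
   metrics share the same scalar [a]. *)
have aK : k ^+ 2 - \tr (K *m K) = a.
  have := congr1 (@mxtrace _ 8) e2; rewrite !(linearZ, linearD, linearB) /=.
  rewrite mxtrace_scalar -/p -/k /a; lra.
rewrite aK in e2.
have e2g : 6 *: (p *: (g *m g) - g *m g *m g) = a *: g - (2 * k)%:M + 2 *: K.
  have := congr1 (mulmx^~ g) e2; rewrite -!scalemxAl mulmxBl -!scalemxAl.
  move=> ->; rewrite mulmxDl mulmxBl -!scalemxAl -mulmxA Kg mulmx1 mul_scalar_mx.
  by rewrite scale_scalar_mx mulr1.
have e1K : 6 *: (k *: K - K *m K) = a%:M - (2 * p) *: g + 2 *: (g *m g).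
  have := congr1 (mulmx^~ K) e1; rewrite -!scalemxAl mulmxBl mul_scalar_mx.
  move=> ->; rewrite mulmxDl mulmxBl -!scalemxAl -!mulmxA gK !mulmx1.
  by rewrite scale_scalar_mx mulr1.
have f1 : a *: g = 8 *: (k%:M - K).
  apply/matrixP => i j; move/matrixP/(_ i j): e1; move/matrixP/(_ i j): e2g.
  by rewrite !mxE; case: (i == j); rewrite /= ?mulr1n ?mulr0n; lra.
have f2 : a *: K = 8 *: (p%:M - g).
  have : a%:M = 8 *: (p *: g - g *m g) :> 'M[R]_8.
    apply/matrixP => i j; move/matrixP/(_ i j): e1K; move/matrixP/(_ i j): e2.
    by rewrite !mxE; case: (i == j); rewrite /= ?mulr1n ?mulr0n; lra.
  move/(congr1 (mulmx^~ K)); rewrite mul_scalar_mx -scalemxAl mulmxBl -scalemxAl.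
  by rewrite -mulmxA gK mulmx1 scale_scalar_mx mulr1.
have t1 : a * p = 56 * k.
  have := congr1 (@mxtrace _ 8) f1; rewrite !(linearZ, linearD, linearB) /=.
  rewrite mxtrace_scalar -/p -/k; lra.
have t2 : a * k = 56 * p.
  have := congr1 (@mxtrace _ 8) f2; rewrite !(linearZ, linearD, linearB) /=.
  rewrite mxtrace_scalar -/p -/k; lra.
have f3 : (64 - a ^+ 2) *: g = (64 * p - 8 * a * k)%:M.
  apply/matrixP => i j; move/matrixP/(_ i j): f1; move/matrixP/(_ i j): f2.
  rewrite !mxE; case: (i == j); rewrite /= ?mulr1n ?mulr0n => h2 h1.
    have := congr1 (fun z => a * z) h1; have := congr1 (fun z => 8 * z) h2.
    by move=> /=; lra.
  have := congr1 (fun z => a * z) h1; have := congr1 (fun z => 8 * z) h2.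
  by move=> /=; lra.
have a64 : 64 - a ^+ 2 != 0.
  apply/negP => /eqP a64; have : a ^+ 2 * p = 56 ^+ 2 * p.
    by rewrite expr2 -mulrA t1 mulrCA t2; ring.
  rewrite (_ : a ^+ 2 = 64); lra.
pose l := (64 * p - 8 * a * k) / (64 - a ^+ 2).
have gl : g = l%:M.
  by rewrite -[g](scalerK a64) f3 scale_scalar_mx mulrC.
have pl : p = 8 * l by rewrite /p gl mxtrace_scalar; ring.
have al : a = 56 * l ^+ 2.
  rewrite /a pl {1 2}gl -scalar_mxM mxtrace_scalar; ring.
(* For scalar [g] the relation [t1] gives [k = 8 l^3], and [t2] then becomes [l^5 = l]; positivity
   of [l] comes from the trace. *)
have l4 : l ^+ 4 = 1.
  have l0 : 0 < l by lra.
  have := t2; have := t1; rewrite al pl => h1 h2.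
  have kk : k = 8 * l ^+ 3 by lra.
  have : 448 * l * (l ^+ 4 - 1) = 0.
    transitivity (56 * l ^+ 2 * (8 * l ^+ 3) - 56 * (8 * l)); first by ring.
    by rewrite -kk h2 subrr.
  by move/eqP; rewrite mulf_eq0 subr_eq0 => /orP[|/eqP//]; rewrite mulf_eq0 (gt_eqF l0) orbF pnatr_eq0.
rewrite gl; congr (_%:M).
have l0 : 0 < l by lra.
by apply/eqP; rewrite -(@pexpr_eq1 _ l 4) ?l4 // ltW.
Qed.

End MetricUniqueness.

(** * The gl(8) action and the projection onto the 7-dimensional 2-forms *)

Definition act (R : realType) (M : 'I_8 -> 'I_8 -> R) (Phi : tensor4 R)
    : tensor4 R := fun a b c d =>
  \sum_p M a p * Phi p b c d + \sum_p M b p * Phi a p c d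
  + \sum_p M c p * Phi a b p d + \sum_p M d p * Phi a b c p.

Definition form_apply (R : realType) (Phi : tensor4 R) (w : 'I_8 -> 'I_8 -> R)
    a b : R := \sum_c \sum_d Phi a b c d * w c d.

Definition dot2 (R : realType) (v w : 'I_8 -> 'I_8 -> R) : R :=
  \sum_a \sum_b v a b * w a b.

Section Action.
Variables (R : realType) (Phi : tensor4 R) (fPhi : is_form4 Phi).
Implicit Types (M : 'I_8 -> 'I_8 -> R).

(** The inner tensor is antisymmetric in its last three slots, so the 24 terms depend only on which
    index stands first: four values, six times each, against the factor [4 / 24]. *)
Lemma alt4_act M a b c d :
  4 * alt4 (fun a b c d => \sum_p M a p * Phi p b c d) a b c d = act M Phi a b c d.
Proof.
rewrite alt4E.
pose Y a b c d := \sum_p M a p * Phi p b c d.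
have Y23 x y z w : Y x z y w = - Y x y z w.
  by rewrite -sumrN; apply: eq_bigr => p _; rewrite (form4_23 fPhi); ring.
have Y34 x y z w : Y x y w z = - Y x y z w.
  by rewrite -sumrN; apply: eq_bigr => p _; rewrite (form4_34 fPhi); ring.
have -> : act M Phi a b c d = Y a b c d - Y b a c d + Y c a b d - Y d a b c.
  rewrite /act -!sumrN; congr (_ + _ + _ + _); apply: eq_bigr => p _.
  - by rewrite (form4_12 fPhi); ring.
  - by rewrite (form4_23 fPhi a p b d) (form4_12 fPhi p a b d); ring.
  - rewrite (form4_34 fPhi a b p c) (form4_23 fPhi a p b c).
    by rewrite (form4_12 fPhi p a b c); ring.
rewrite -![\sum_(p < 8) _]/(Y _ _ _ _).
rewrite (Y34 a b c d) (Y23 a b c d) (Y34 a c b d) (Y23 a b c d).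
rewrite (Y23 a b d c) (Y34 a b c d) (Y34 a d b c) (Y23 a b d c) (Y34 a b c d).
rewrite (Y34 b a c d) (Y23 b a c d) (Y34 b c a d) (Y23 b a c d).
rewrite (Y23 b a d c) (Y34 b a c d) (Y34 b d a c) (Y23 b a d c) (Y34 b a c d).
rewrite (Y34 c a b d) (Y23 c a b d) (Y34 c b a d) (Y23 c a b d).
rewrite (Y23 c a d b) (Y34 c a b d) (Y34 c d a b) (Y23 c a d b) (Y34 c a b d).
rewrite (Y34 d a b c) (Y23 d a b c) (Y34 d b a c) (Y23 d a b c).
rewrite (Y23 d a c b) (Y34 d a b c) (Y34 d c a b) (Y23 d a c b) (Y34 d a b c).
lra.
Qed.

Lemma actB M N a b c d :
  act (fun a b => M a b - N a b) Phi a b c d = act M Phi a b c d - act N Phi a b c d.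
Proof.
have E (F : 'I_8 -> R) x : \sum_p (M x p - N x p) * F p =
   \sum_p M x p * F p - \sum_p N x p * F p.
  by rewrite -sumrB; apply: eq_bigr => p _; rewrite mulrBl.
rewrite /act !E; ring.
Qed.

Hypothesis cid : cayley_identity 1%:M Phi.
Local Notation eta := (1%:M : 'M[R]_8).

(** The term acting on the free slot gives [42 M] by the triple contraction. The other three terms
    are equal to one another by antisymmetry and are found from the double contraction, whence
    [24 = 42 - 3 * 6], [18 = 3 * 6] and [12 = 3 * 4]. *)
Lemma act_contr M a e :
  \sum_b \sum_c \sum_d act M Phi a b c d * Phi e b c d =
  24 * M a e + 18 * (\sum_b M b b) * eta a e - 12 * \sum_b \sum_p M b p * Phi a p e b.
Proof.
have E1 : \sum_b \sum_c \sum_d (\sum_p M a p * Phi p b c d) * Phi e b c d = 42 * M a e.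
  transitivity (\sum_p M a p * (42 * eta p e)); last first.
    by under eq_bigr do rewrite mulrCA; rewrite -mulr_sumr sum_mx1rC.
  transitivity (\sum_p \sum_b \sum_c \sum_d M a p * (Phi p b c d * Phi e b c d)).
    rewrite [RHS]exchange_big; apply: eq_bigr => b _.
    rewrite [RHS]exchange_big; apply: eq_bigr => c _.
    rewrite [RHS]exchange_big; apply: eq_bigr => d _.
    by rewrite mulr_suml; apply: eq_bigr => p _; ring.
  apply: eq_bigr => p _; rewrite -(flat_contr3 fPhi cid) mulr_sumr.
  apply: eq_bigr => b _; rewrite mulr_sumr.
  by apply: eq_bigr => c _; rewrite mulr_sumr.
pose Z := 6 * ((\sum_b M b b) * eta a e - M a e) - 4 * \sum_b \sum_p M b p * Phi a p e b.
have E2 : \sum_b \sum_c \sum_d (\sum_p M b p * Phi a p c d) * Phi e b c d = Z.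
  transitivity (\sum_b \sum_p M b p *
      (6 * (eta a e * eta p b - eta a b * eta p e) - 4 * Phi a p e b)).
    transitivity (\sum_b \sum_p \sum_c \sum_d M b p * (Phi a p c d * Phi e b c d)).
      apply: eq_bigr => b _.
      rewrite [RHS]exchange_big; apply: eq_bigr => c _.
      rewrite [RHS]exchange_big; apply: eq_bigr => d _.
      by rewrite mulr_suml; apply: eq_bigr => p _; ring.
    apply: eq_bigr => b _; apply: eq_bigr => p _.
    rewrite -(flat_contr2 fPhi cid) mulr_sumr.
    by apply: eq_bigr => c _; rewrite mulr_sumr.
  have T1 : \sum_b \sum_p eta p b * M b p = \sum_b M b b.
    by apply: eq_bigr => b _; rewrite sum_mx1r.
  have T2 : \sum_b \sum_p eta a b * (eta p e * M b p) = M a e.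
    by under eq_bigr do rewrite -mulr_sumr sum_mx1r; rewrite sum_mx1l.
  rewrite /Z -T1 -T2 mulrBr (mulrC _ (eta a e)).
  rewrite !mulr_sumr -!sumrN -!big_split /=; apply: eq_bigr => b _.
  rewrite !mulr_sumr -!sumrN -!big_split /=; apply: eq_bigr => p _; ring.
have E3 : \sum_b \sum_c \sum_d (\sum_p M c p * Phi a b p d) * Phi e b c d = Z.
  rewrite -E2 exchange_big; apply: eq_bigr => c _; apply: eq_bigr => b _.
  apply: eq_bigr => d _; rewrite !mulr_suml; apply: eq_bigr => p _.
  by rewrite (form4_23 fPhi a b p) (form4_23 fPhi e b c); ring.
have E4 : \sum_b \sum_c \sum_d (\sum_p M d p * Phi a b c p) * Phi e b c d = Z.
  rewrite -E3; apply: eq_bigr => b _; rewrite exchange_big.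
  apply: eq_bigr => d _; apply: eq_bigr => c _; rewrite !mulr_suml.
  apply: eq_bigr => p _.
  by rewrite (form4_34 fPhi a b c p) (form4_34 fPhi e b c d); ring.
transitivity (42 * M a e + Z + Z + Z); last by rewrite /Z; ring.
rewrite -[in 42 * _]E1 -{1}E2 -{1}E3 -{1}E4 -!big_split; apply: eq_bigr => b _.
rewrite -!big_split; apply: eq_bigr => c _; rewrite -!big_split.
by apply: eq_bigr => d _; rewrite /act /= !mulrDl.
Qed.
End Action.

Section FormApply.
Variables (R : realType) (Phi : tensor4 R).
Hypotheses (fPhi : is_form4 Phi) (cid : cayley_identity 1%:M Phi).
Implicit Types (v w : 'I_8 -> 'I_8 -> R).
Local Notation eta := (1%:M : 'M[R]_8).

Lemma form_applyN w a b : form_apply Phi w b a = - form_apply Phi w a b.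
Proof.
rewrite -sumrN; apply: eq_bigr => c _; rewrite -sumrN; apply: eq_bigr => d _.
by rewrite (form4_12 fPhi); ring.
Qed.

Lemma form_applyB v w a b :
  form_apply Phi (fun c d => v c d - w c d) a b =
  form_apply Phi v a b - form_apply Phi w a b.
Proof.
rewrite -sumrB; apply: eq_bigr => c _; rewrite -sumrB; apply: eq_bigr => d _; ring.
Qed.

Lemma form_apply_self_adjoint v w :
  dot2 v (form_apply Phi w) = dot2 (form_apply Phi v) w.
Proof.
transitivity (sum4 (fun a b c d => v a b * Phi a b c d * w c d)).
  apply: eq_bigr => a _; apply: eq_bigr => b _; rewrite mulr_sumr.
  by apply: eq_bigr => c _; rewrite mulr_sumr; apply: eq_bigr => d _; ring.
rewrite sum4_13 sum4_24; apply: eq_bigr => a _; apply: eq_bigr => b _.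
rewrite mulr_suml; apply: eq_bigr => c _; rewrite mulr_suml.
apply: eq_bigr => d _.
by rewrite (form4_13 fPhi a) (form4_24 fPhi a); ring.
Qed.

(** On 2-forms the operator [F] of [form_apply] satisfies [F^2 = 12 - 4 F], that is
    [(F + 6)(F - 2) = 0], by the double contraction; self-adjointness moves one [F] across the
    product. *)
Lemma form_apply_dot v w : (forall a b, w b a = - w a b) ->
  dot2 (form_apply Phi v) (form_apply Phi w) =
  12 * dot2 v w - 4 * dot2 v (form_apply Phi w).
Proof.
move=> wN; rewrite -form_apply_self_adjoint.
have sq a b : form_apply Phi (form_apply Phi w) a b =
    12 * w a b - 4 * form_apply Phi w a b.
  transitivity (\sum_e \sum_f
      (6 * (eta a e * eta b f - eta a f * eta b e) - 4 * Phi a b e f) * w e f).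
    transitivity (sum4 (fun c d e f => Phi a b c d * Phi c d e f * w e f)).
      apply: eq_bigr => c _; apply: eq_bigr => d _; rewrite mulr_sumr.
      apply: eq_bigr => e _; rewrite mulr_sumr; apply: eq_bigr => f _; ring.
    rewrite sum4_13 sum4_24; apply: eq_bigr => e _; apply: eq_bigr => f _.
    rewrite -(flat_contr2 fPhi cid) mulr_suml; apply: eq_bigr => c _.
    rewrite mulr_suml; apply: eq_bigr => d _.
    by rewrite (form4_13 fPhi e) (form4_24 fPhi e); ring.
  have T1 : \sum_e \sum_f eta a e * (eta b f * w e f) = w a b.
    by under eq_bigr do rewrite -mulr_sumr sum_mx1l; rewrite sum_mx1l.
  have T2 : \sum_e \sum_f eta a f * (eta b e * w e f) = w b a.
    by under eq_bigr do rewrite sum_mx1l; rewrite sum_mx1l.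
  transitivity (6 * w a b - 6 * w b a - 4 * form_apply Phi w a b); last first.
    by rewrite (wN a b); ring.
  rewrite -{1}T1 -T2 !mulr_sumr -!sumrN -!big_split /=; apply: eq_bigr => e _.
  rewrite !mulr_sumr -!sumrN -!big_split /=; apply: eq_bigr => f _; ring.
rewrite !mulr_sumr -!sumrN -!big_split /=; apply: eq_bigr => a _.
rewrite !mulr_sumr -!sumrN -!big_split /=; apply: eq_bigr => b _.
rewrite sq; ring.
Qed.

(** The uncontracted Cayley identity is weighted with [v_jk w_bc]. Its fifteen terms fall into the
    few kinds named below; the mixed products [W] stay unevaluated. It yields both the Clifford
    relation and the trace of the torsion. *)
Lemma form_apply_quad v w i a :
    (forall a b, v b a = - v a b) -> (forall a b, w b a = - w a b) ->
  \sum_p form_apply Phi v i p * form_apply Phi w a p =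
    eta i a * (2 * dot2 v w - dot2 v (form_apply Phi w))
  - 4 * (\sum_e w i e * v a e) - 2 * (\sum_k v a k * form_apply Phi w k i)
  - 2 * (\sum_c w i c * form_apply Phi v c a)
  - 4 * \sum_k \sum_c Phi k i c a * \sum_e v e k * w e c.
Proof.
move=> vN wN.
transitivity (sum4 (fun j k b c => v j k * w b c * \sum_p Phi i j k p * Phi a b c p)).
  transitivity (\sum_p sum4 (fun j k b c => v j k * w b c * (Phi i j k p * Phi a b c p))).
    apply: eq_bigr => p _; rewrite mulr_suml; apply: eq_bigr => j _.
    rewrite mulr_suml; apply: eq_bigr => k _; rewrite mulr_sumr.
    apply: eq_bigr => b _; rewrite mulr_sumr; apply: eq_bigr => c _.
    by rewrite (form4_23 fPhi i j p k) (form4_34 fPhi i j k p)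
      (form4_23 fPhi a b p c) (form4_34 fPhi a b c p); ring.
  rewrite /sum4 exchange_big; apply: eq_bigr => j _.
  rewrite exchange_big; apply: eq_bigr => k _.
  rewrite exchange_big; apply: eq_bigr => b _.
  rewrite exchange_big; apply: eq_bigr => c _.
  by rewrite mulr_sumr.
pose vw j k b c := v j k * w b c.
have D : dot2 v w = sum4 (fun j k b c => eta j b * (eta k c * vw j k b c)).
  apply: eq_bigr => j _; apply: eq_bigr => k _.
  by under eq_bigr do (rewrite -mulr_sumr sum_mx1l); rewrite sum_mx1l.
have D' : - dot2 v w = sum4 (fun j k b c => eta k b * (eta j c * vw j k b c)).
  rewrite -sumrN; apply: eq_bigr => j _; rewrite -sumrN; apply: eq_bigr => k _.
  under eq_bigr do (rewrite -mulr_sumr sum_mx1l); rewrite sum_mx1l.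
  by rewrite /vw (wN j k); ring.
have P : dot2 v (form_apply Phi w) = sum4 (fun j k b c => Phi j k b c * vw j k b c).
  apply: eq_bigr => j _; apply: eq_bigr => k _; rewrite mulr_sumr.
  apply: eq_bigr => b _; rewrite mulr_sumr; apply: eq_bigr => c _; rewrite /vw; ring.
pose Y := \sum_e w i e * v a e.
have Y1 : sum4 (fun j k b c => eta k a * (eta i b * (eta j c * vw j k b c))) = - Y.
  rewrite -sumrN; apply: eq_bigr => j _.
  under eq_bigr do (under eq_bigr do rewrite -!mulr_sumr sum_mx1l;
    rewrite -mulr_sumr sum_mx1l).
  by rewrite sum_mx1r /vw (vN a j); ring.
have Y2 : sum4 (fun j k b c => eta j a * (eta i c * (eta k b * vw j k b c))) = - Y.
  rewrite sum4_12 -sumrN; apply: eq_bigr => k _.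
  under eq_bigr do (under eq_bigr do rewrite -!mulr_sumr sum_mx1l;
    rewrite -mulr_sumr sum_mx1l).
  by rewrite sum_mx1r /vw (wN i k); ring.
have Y3 : sum4 (fun j k b c => eta k a * (eta i c * (eta j b * vw j k b c))) = Y.
  apply: eq_bigr => j _.
  under eq_bigr do (under eq_bigr do rewrite -!mulr_sumr sum_mx1l;
    rewrite -mulr_sumr sum_mx1l).
  by rewrite sum_mx1r /vw (wN i j) (vN a j); ring.
have Y4 : sum4 (fun j k b c => eta j a * (eta i b * (eta k c * vw j k b c))) = Y.
  rewrite sum4_12; apply: eq_bigr => k _.
  under eq_bigr do (under eq_bigr do rewrite -!mulr_sumr sum_mx1l;
    rewrite -mulr_sumr sum_mx1l).
  by rewrite sum_mx1r /vw; ring.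
pose Z := \sum_k v a k * form_apply Phi w k i.
have Z1 : sum4 (fun j k b c => eta j a * (Phi k i b c * vw j k b c)) = Z.
  rewrite sum4_12; apply: eq_bigr => k _.
  under eq_bigr do (under eq_bigr do rewrite -mulr_sumr; rewrite -mulr_sumr).
  rewrite sum_mx1r mulr_sumr; apply: eq_bigr => b _; rewrite mulr_sumr.
  by apply: eq_bigr => c _; rewrite /vw; ring.
have Z2 : sum4 (fun j k b c => eta k a * (Phi i j b c * vw j k b c)) = Z.
  apply: eq_bigr => k _.
  under eq_bigr do (under eq_bigr do rewrite -mulr_sumr; rewrite -mulr_sumr).
  rewrite sum_mx1r mulr_sumr; apply: eq_bigr => b _; rewrite mulr_sumr.
  by apply: eq_bigr => c _; rewrite /vw (form4_12 fPhi k i) (vN a k); ring.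
pose U := \sum_c w i c * form_apply Phi v c a.
have U1 : sum4 (fun j k b c => eta i b * (Phi j k c a * vw j k b c)) = U.
  rewrite sum4_23 sum4_34 sum4_12 sum4_23 sum4_12; apply: eq_bigr => c _.
  under eq_bigr do (under eq_bigr do rewrite -mulr_sumr; rewrite -mulr_sumr).
  rewrite sum_mx1l mulr_sumr; apply: eq_bigr => j _; rewrite mulr_sumr.
  apply: eq_bigr => k _.
  by rewrite /vw (form4_13 fPhi c k j a) (form4_24 fPhi c a j k); ring.
have U2 : sum4 (fun j k b c => eta i c * (Phi j k a b * vw j k b c)) = U.
  rewrite sum4_23 sum4_34 sum4_12 sum4_23; apply: eq_bigr => b _.
  under eq_bigr do (under eq_bigr do rewrite -mulr_sumr; rewrite -mulr_sumr).
  rewrite sum_mx1l mulr_sumr; apply: eq_bigr => j _; rewrite mulr_sumr.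
  apply: eq_bigr => k _.
  rewrite /vw (wN i b) (form4_13 fPhi a k j b) (form4_24 fPhi a b j k).
  by rewrite (form4_12 fPhi b a j k); ring.
pose W := \sum_k \sum_c Phi k i c a * \sum_e v e k * w e c.
have W1 : sum4 (fun j k b c => eta j b * (Phi k i c a * vw j k b c)) = W.
  rewrite sum4_12 sum4_34 sum4_23; apply: eq_bigr => k _; apply: eq_bigr => c _.
  by under eq_bigr do rewrite sum_mx1l; rewrite -mulr_sumr.
have W2 : sum4 (fun j k b c => eta k b * (Phi i j c a * vw j k b c)) = W.
  rewrite sum4_34 sum4_23; apply: eq_bigr => j _; apply: eq_bigr => c _.
  under eq_bigr do rewrite sum_mx1l; rewrite mulr_sumr; apply: eq_bigr => k _.
  by rewrite /vw (form4_12 fPhi j i) (vN k j); ring.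
have W3 : sum4 (fun j k b c => eta j c * (Phi k i a b * vw j k b c)) = W.
  rewrite sum4_12 sum4_23; apply: eq_bigr => k _; apply: eq_bigr => b _.
  under eq_bigr do rewrite sum_mx1l; rewrite mulr_sumr; apply: eq_bigr => j _.
  by rewrite /vw (form4_34 fPhi k i b a) (wN j b); ring.
have W4 : sum4 (fun j k b c => eta k c * (Phi i j a b * vw j k b c)) = W.
  rewrite sum4_23; apply: eq_bigr => j _; apply: eq_bigr => b _.
  under eq_bigr do rewrite sum_mx1l; rewrite mulr_sumr; apply: eq_bigr => k _.
  rewrite /vw (form4_12 fPhi j i) (form4_34 fPhi j i b a) (vN k j) (wN k b); ring.
transitivity (eta i a * dot2 v w - Y - Y - eta i a * - dot2 v w - Y - Y
  - eta i a * dot2 v (form_apply Phi w) - Z - Z - U - W - W - U - W - W);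
  last by rewrite -/Y -/Z -/U -/W; ring.
rewrite {1}D D' P -{1}Y1 -{1}Y2 -{1}Y3 -{1}Y4 -{1}Z1 -Z2 -{1}U1 -{1}W1 -{1}W2.
rewrite -U2 -{1}W3 -W4 -!sum4Z -!sum4D -!sum4B.
by apply: eq_sum4 => j k b c; rewrite (flat_contr1 cid) /vw; ring.
Qed.
End FormApply.

(* [J2] has eigenvalues [-3] and [1] on 2-forms and is half of [form_apply], so
   the projection onto the eigenvalue [-3] is [(1 - J2) / 4]. *)
Definition four_proj7 (R : realType) (Phi : tensor4 R) (w : 'I_8 -> 'I_8 -> R)
    a b : R := w a b - 2^-1 * form_apply Phi w a b.

(** * The Clifford relation and the quadratic invariants of the torsion *)

Section TorsionAlgebra.
Variables (R : realType) (Phi : tensor4 R).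
Hypotheses (fPhi : is_form4 Phi) (cid : cayley_identity 1%:M Phi).
Implicit Types (v w : 'I_8 -> 'I_8 -> R).
Local Notation eta := (1%:M : 'M[R]_8).

(** This is the Clifford relation for the 7-dimensional summand acting on R^8. For two eigenvectors
    [form_apply_quad] reads [36 X_ia = 8 eta_ia v.w - 28 X_ai - 4 W_ia]. As [W] is antisymmetric in
    [i, a], adding the transpose gives [64 (X_ia + X_ai) = 16 eta_ia v.w]. *)
Lemma Lambda27_anticommute v w i a :
    (forall a b, v b a = - v a b) -> (forall a b, w b a = - w a b) ->
    (forall a b, form_apply Phi v a b = - 6 * v a b) ->
    (forall a b, form_apply Phi w a b = - 6 * w a b) ->
  \sum_e (v i e * w a e + w i e * v a e) = 4^-1 * (eta i a * dot2 v w).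
Proof.
move=> vN wN v7 w7; pose X i a := \sum_e v i e * w a e.
pose W i a := \sum_k \sum_c Phi k i c a * \sum_e v e k * w e c.
have main i' a' :
    36 * X i' a' = 8 * (eta i' a' * dot2 v w) - 28 * X a' i' - 4 * W i' a'.
  have := form_apply_quad fPhi cid i' a' vN wN.
  have -> : \sum_p form_apply Phi v i' p * form_apply Phi w a' p = 36 * X i' a'.
    by rewrite mulr_sumr; apply: eq_bigr => p _; rewrite v7 w7; ring.
  have -> : dot2 v (form_apply Phi w) = - 6 * dot2 v w.
    rewrite mulr_sumr; apply: eq_bigr => p _; rewrite mulr_sumr.
    by apply: eq_bigr => q _; rewrite w7; ring.
  have -> : \sum_e w i' e * v a' e = X a' i'.
    by apply: eq_bigr => e _; rewrite mulrC.
  have -> : \sum_k v a' k * form_apply Phi w k i' = 6 * X a' i'.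
    by rewrite mulr_sumr; apply: eq_bigr => e _; rewrite w7 (wN i'); ring.
  have -> : \sum_c w i' c * form_apply Phi v c a' = 6 * X a' i'.
    by rewrite mulr_sumr; apply: eq_bigr => e _; rewrite v7 (vN a'); ring.
  by move=> ->; rewrite -/(W i' a'); ring.
have WN : W a i = - W i a.
  rewrite -sumrN; apply: eq_bigr => k _; rewrite -sumrN; apply: eq_bigr => c _.
  by rewrite (form4_24 fPhi); ring.
have -> : \sum_e (v i e * w a e + w i e * v a e) = X i a + X a i.
  by rewrite -big_split; apply: eq_bigr => e _; rewrite [in RHS]mulrC addrC
    [w i e * _]mulrC addrC [w a e * _]mulrC.
have := main i a; have := main a i; rewrite (etaC R a i) WN; lra.
Qed.

Lemma four_proj7B v w a b :
  four_proj7 Phi (fun c d => v c d - w c d) a b =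
  four_proj7 Phi v a b - four_proj7 Phi w a b.
Proof. by rewrite /four_proj7 form_applyB; ring. Qed.

Lemma dot2_four_proj7 v w :
  dot2 v (four_proj7 Phi w) = dot2 v w - 2^-1 * dot2 v (form_apply Phi w).
Proof.
rewrite mulr_sumr -sumrB; apply: eq_bigr => a _.
rewrite mulr_sumr -sumrB; apply: eq_bigr => b _; rewrite /four_proj7; ring.
Qed.

(** Four times a self-adjoint projection squares to four times itself. *)
Lemma four_proj7_dot v w : (forall a b, w b a = - w a b) ->
  dot2 (four_proj7 Phi v) (four_proj7 Phi w) = 4 * dot2 v (four_proj7 Phi w).
Proof.
move=> wN; have E := form_apply_dot fPhi cid v wN.
have E' := form_apply_self_adjoint fPhi v w.
transitivity (dot2 v w - 2^-1 * dot2 v (form_apply Phi w)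
  - 2^-1 * dot2 (form_apply Phi v) w
  + 4^-1 * dot2 (form_apply Phi v) (form_apply Phi w)).
  rewrite !mulr_sumr -!sumrN -!big_split; apply: eq_bigr => a _ /=.
  rewrite !mulr_sumr -!sumrN -!big_split; apply: eq_bigr => b _ /=.
  rewrite /four_proj7; lra.
rewrite dot2_four_proj7; lra.
Qed.

(** For antisymmetric [v] the contraction [act_contr] equals [24 v - 12 F v], with [F] for
    [form_apply], which is 24 times [four_proj7 Phi v]. *)
Lemma act_eq0_four_proj7 v a b : (forall a b, v b a = - v a b) ->
  (forall a b c d, act v Phi a b c d = 0) -> four_proj7 Phi v a b = 0.
Proof.
move=> vN v0; have := act_contr fPhi cid v a b.
rewrite big1 => [|i _]; last first.
  by rewrite big1 // => j _; rewrite big1 // => k _; rewrite v0 mul0r.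
rewrite [X in 18 * X]big1 => [|i _]; last exact/eqN_eq0/vN.
have -> : \sum_c \sum_p v c p * Phi a p b c = form_apply Phi v a b.
  apply: eq_bigr => c _; apply: eq_bigr => p _.
  by rewrite (form4_23 fPhi a b p c) (form4_34 fPhi a b c p); ring.
rewrite /four_proj7; lra.
Qed.

Variable t : tensor3 R.
Hypothesis ft : is_form3 t.

Let t12 a b c : t b a c = - t a b c. Proof. by have [] := ft a b c. Qed.
Let t23 a b c : t a c b = - t a b c. Proof. by have [] := ft a b c. Qed.
Let t231 a b c : t b c a = t a b c.
Proof. by rewrite t23 t12 opprK. Qed.

Let T2 := \sum_i dot2 (t i) (t i).
Let Q := \sum_i dot2 (t i) (form_apply Phi (t i)).

Lemma torsion_norm_sq :
  \sum_i dot2 (four_proj7 Phi (t i)) (four_proj7 Phi (t i)) = 4 * T2 - 2 * Q.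
Proof.
rewrite !mulr_sumr -sumrB; apply: eq_bigr => i _.
rewrite four_proj7_dot ?dot2_four_proj7; last by move=> *; exact: t23.
lra.
Qed.

(** The trace of [t] itself vanishes, so only [form_apply] of [t i] contributes and
    [form_apply_quad] applies with [v = t i], [w = t a]. Summed over [i] and [a], total antisymmetry
    of [t] reduces every term to [T2] or [Q]. *)
Lemma torsion_trace_sq :
  \sum_p (\sum_i four_proj7 Phi (t i) i p) ^+ 2 = 3 / 2 * T2 - 9 / 4 * Q.
Proof.
have trE p : \sum_i four_proj7 Phi (t i) i p =
    - 2^-1 * \sum_i form_apply Phi (t i) i p.
  rewrite mulr_sumr; apply: eq_bigr => i _; rewrite /four_proj7.
  have -> : t i i p = 0 by apply/eqN_eq0/t12.
  by ring.
transitivity (4^-1 * \sum_i \sum_a \sum_p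
    form_apply Phi (t i) i p * form_apply Phi (t a) a p).
  transitivity (4^-1 * \sum_p \sum_i \sum_a
      form_apply Phi (t i) i p * form_apply Phi (t a) a p).
    rewrite mulr_sumr; apply: eq_bigr => p _; rewrite trE.
    set s := \sum_i form_apply Phi (t i) i p.
    have -> : \sum_i \sum_a form_apply Phi (t i) i p * form_apply Phi (t a) a p = s * s.
      by rewrite mulr_suml; apply: eq_bigr => i _; rewrite mulr_sumr.
    lra.
  by rewrite exchange_big; congr (_ * _); apply: eq_bigr => i _; rewrite exchange_big.
under eq_bigr do under eq_bigr do
  rewrite (form_apply_quad fPhi cid _ _ (fun a b => t23 _ a b) (fun a b => t23 _ a b)).
have S1 : \sum_i \sum_a eta i a * (2 * dot2 (t i) (t a) -
    dot2 (t i) (form_apply Phi (t a))) = 2 * T2 - Q.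
  by under eq_bigr do rewrite sum_mx1l; rewrite sumrB -mulr_sumr.
have S2 : \sum_i \sum_a \sum_e t a i e * t i a e = - T2.
  rewrite -sumrN; apply: eq_bigr => i _; rewrite -sumrN; apply: eq_bigr => a _.
  by rewrite -sumrN; apply: eq_bigr => e _; rewrite t12; ring.
have S3 : \sum_i \sum_a \sum_k t i a k * form_apply Phi (t a) k i = Q.
  rewrite exchange_big; apply: eq_bigr => a _; rewrite exchange_big.
  by apply: eq_bigr => k _; apply: eq_bigr => i _; rewrite -(t231 i a k).
have S4 : \sum_i \sum_a \sum_k t a i k * form_apply Phi (t i) k a = Q.
  rewrite -S3 exchange_big; apply: eq_bigr => a _; apply: eq_bigr => i _; by [].
have S5 : \sum_i \sum_a \sum_k \sum_c Phi k i c a * (\sum_e t i e k * t a e c) = Q.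
  transitivity (sum4 (fun i a k c => \sum_e t e k i * (Phi k i c a * t e c a))).
    apply: eq_bigr => i _; apply: eq_bigr => a _; apply: eq_bigr => k _.
    apply: eq_bigr => c _; rewrite mulr_sumr; apply: eq_bigr => e _.
    by rewrite -(t231 i e k) -(t231 a e c); ring.
  transitivity (\sum_e sum4 (fun i a k c => t e k i * (Phi k i c a * t e c a))).
    symmetry; rewrite /sum4 exchange_big; apply: eq_bigr => i _.
    rewrite exchange_big; apply: eq_bigr => a _.
    by rewrite exchange_big; apply: eq_bigr => k _; rewrite exchange_big.
  apply: eq_bigr => e _; rewrite sum4_23 sum4_12 sum4_34.
  apply: eq_bigr => k _; apply: eq_bigr => i _; rewrite mulr_sumr.
  by apply: eq_bigr => c _; rewrite mulr_sumr; apply: eq_bigr => a _.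
transitivity (4^-1 * ((2 * T2 - Q) - 4 * - T2 - 2 * Q - 2 * Q - 4 * Q)); last lra.
rewrite -S1 -{1}S2 -{1}S3 -{1}S4 -S5; congr (_ * _).
rewrite !mulr_sumr -!sumrN -!big_split /=; apply: eq_bigr => i _.
by rewrite !mulr_sumr -!sumrN -!big_split /=.
Qed.

End TorsionAlgebra.

(** * The action density and the first-order metric on the flat background *)

Section FlatAction.
Variables (R : realType) (Phi : tensor4 R).
Hypotheses (fPhi : is_form4 Phi) (cid : cayley_identity 1%:M Phi).
Local Notation eta := (1%:M : 'M[R]_8).

Lemma dot3_flat (S T : tensor3 R) :
  dot3 1%:M S T = \sum_a dot2 (S a) (T a).
Proof.
apply: eq_bigr => a _; apply: eq_bigr => b _; apply: eq_bigr => c _.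
rewrite invmx1; transitivity (\sum_a' eta a a' * \sum_b' eta b b' *
  \sum_c' eta c c' * (S a b c * T a' b' c')); last by rewrite !sum_mx1l.
apply: eq_bigr => a' _; rewrite mulr_sumr; apply: eq_bigr => b' _.
by rewrite !mulr_sumr; apply: eq_bigr => c' _; ring.
Qed.

Lemma J3_flat (t : tensor3 R) i j k : 
  J3 1%:M Phi t i j k = 2^-1 * (form_apply Phi (t k) i j
    + form_apply Phi (t i) j k + form_apply Phi (t j) k i).
Proof.
rewrite /J3 invmx1 alt3E.
have E x y z : \sum_p \sum_q \sum_p' \sum_q' Phi x y p' q' * eta p' p * eta q' q
    * t z p q = form_apply Phi (t z) x y.
  apply: eq_bigr => p _; apply: eq_bigr => q _.
  transitivity (\sum_p' (\sum_q' Phi x y p' q' * eta q' q) * eta p' p * t z p q).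
    apply: eq_bigr => p' _; rewrite !mulr_suml; apply: eq_bigr => q' _; ring.
  by rewrite -mulr_suml sum_mx1rC sum_mx1rC.
rewrite !E (form_applyN fPhi (t j) k i) (form_applyN fPhi (t k) i j).
by rewrite (form_applyN fPhi (t i) j k); lra.
Qed.

Lemma dot3_J3_flat (t : tensor3 R) : is_form3 t ->
  dot3 1%:M t (J3 1%:M Phi t) =
  3 / 2 * \sum_i dot2 (t i) (form_apply Phi (t i)).
Proof.
move=> ft; have t12 a b c : t b a c = - t a b c by have [] := ft a b c.
have t23 a b c : t a c b = - t a b c by have [] := ft a b c.
have t231 a b c : t b c a = t a b c by rewrite t23 t12 opprK.
set Q := \sum_i _; rewrite dot3_flat.
have Q1 : \sum_i \sum_j \sum_k t i j k * form_apply Phi (t i) j k = Q by [].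
have Q2 : \sum_i \sum_j \sum_k t i j k * form_apply Phi (t j) k i = Q.
  rewrite exchange_big -Q1; apply: eq_bigr => j _; rewrite exchange_big.
  by apply: eq_bigr => k _; apply: eq_bigr => i _; rewrite -(t231 i j k).
have Q3 : \sum_i \sum_j \sum_k t i j k * form_apply Phi (t k) i j = Q.
  under eq_bigr do rewrite exchange_big; rewrite exchange_big -Q1.
  apply: eq_bigr => k _; apply: eq_bigr => i _; apply: eq_bigr => j _.
  by rewrite (t231 k i j).
transitivity (2^-1 * Q + 2^-1 * Q + 2^-1 * Q); last lra.
rewrite -[in X in X + _ + _]Q3 -[in X in _ + X + _]Q1 -[in X in _ + X]Q2.
rewrite !mulr_sumr -!big_split; apply: eq_bigr => i _ /=.
rewrite !mulr_sumr -!big_split; apply: eq_bigr => j _ /=.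
rewrite !mulr_sumr -!big_split; apply: eq_bigr => k _ /=.
rewrite J3_flat; lra.
Qed.

(** The coefficients [3/8 (6 + kappa)] and [6 - 3 kappa] solve the linear system that expresses
    [3/2 (6 - 5 kappa) Q + 6 kappa T2] through the two squares. The excluded values of [kappa] are
    the roots of the denominator. *)
Lemma action_density_flat (kappa : R) (t : tensor3 R) :
  kappa != 1 -> kappa != - 6 -> is_form3 t ->
  let A i := four_proj7 Phi (t i) in
  (1 - 5 * kappa / 6 - kappa ^+ 2 / 6) * action_density kappa 1%:M Phi t =
  36^-1 * (3 / 8 * (6 + kappa) * (\sum_i dot2 (A i) (A i))
           - (6 - 3 * kappa) * \sum_p (\sum_i A i i p) ^+ 2).
Proof.
move=> k1 k6 ft A; rewrite (torsion_norm_sq fPhi cid ft).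
rewrite (torsion_trace_sq fPhi cid ft) /action_density det1 sqrtr1.
rewrite (dot3_J3_flat ft) dot3_flat.
set T2 := \sum_i dot2 (t i) (t i); set Q := \sum_i _.
have k0 : 6 - (5 + kappa) * kappa != 0.
  have -> : 6 - (5 + kappa) * kappa = (kappa - 1) * - (kappa - - 6) by ring.
  by rewrite mulf_neq0 ?oppr_eq0 ?subr_eq0.
by field.
Qed.

(** The expression is symmetric in [i, a], so the antisymmetric part [w] cancels and
    [48 h + 36 tr h = 24 gamma + 18 tr gamma] remains, traces being multiples of [eta]. Its trace
    gives [tr gamma = 2 tr h], and then [gamma = 2 h]. *)
Lemma linearised_metric (h w gamma : 'M[R]_8) :
    h^T = h -> w^T = - w -> gamma^T = gamma ->
    (forall i a, \sum_j \sum_k \sum_p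
        (act (h + w) Phi i j k p * Phi a j k p
         + Phi i j k p * act (h + w) Phi a j k p)
      - \sum_j \sum_k \sum_p \sum_q Phi i j k p * gamma p q * Phi a j k q
      = 12 * \tr gamma * eta i a + 30 * gamma i a) ->
  gamma = 2 *: h.
Proof.
move=> hT wT gT lin; pose M := h + w.
have hC i a : h a i = h i a by rewrite -[in LHS]hT mxE.
have wN i a : w a i = - w i a by rewrite -[in LHS](opprK w) -wT !mxE.
have trM : \sum_b M b b = \tr h.
  apply: eq_bigr => b _; rewrite mxE.
  by rewrite (eqN_eq0 (wN b b)) addr0.
pose X i a := \sum_b \sum_p M b p * Phi i p a b.
have XN i a : X a i = - X i a.
  rewrite -sumrN; apply: eq_bigr => b _; rewrite -sumrN; apply: eq_bigr => p _.
  by rewrite (form4_13 fPhi); ring.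
have key i a : 48 * h i a + 36 * \tr h * eta i a =
    18 * \tr gamma * eta i a + 24 * gamma i a.
  have := lin i a; rewrite (flat_contr_sym fPhi cid _ _ gT).
  have -> : \sum_j \sum_k \sum_p (act M Phi i j k p * Phi a j k p
         + Phi i j k p * act M Phi a j k p) =
      24 * M i a + 24 * M a i + 36 * \tr h * eta i a.
    transitivity (\sum_j \sum_k \sum_p act M Phi i j k p * Phi a j k p
      + \sum_j \sum_k \sum_p act M Phi a j k p * Phi i j k p).
      do 2!(rewrite -big_split; apply: eq_bigr => ? _ /=).
      by rewrite -big_split; apply: eq_bigr => p _ /=; ring.
    rewrite !(act_contr fPhi cid) -/(X i a) -/(X a i) XN trM (etaC R a i); ring.
  have ME b c : M b c = h b c + w b c by rewrite mxE.
  rewrite !ME (hC i a) (wN i a). lra.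
have trk : \tr gamma = 2 * \tr h.
  have : \sum_i (48 * h i i + 36 * \tr h * eta i i) =
     \sum_i (18 * \tr gamma * eta i i + 24 * gamma i i).
    by apply: eq_bigr => i _; exact: key.
  have trE (A : 'M[R]_8) : \sum_i A i i = \tr A by [].
  by rewrite !big_split /= -!mulr_sumr !trE mxtrace1; lra.
by apply/matrixP => i a; rewrite [RHS]mxE; have := key i a; rewrite trk; lra.
Qed.

End FlatAction.

(** * Directional derivatives *)

Section Derivatives.
Variables (R : realType) (V : normedModType R).
Implicit Types (f g : V -> R) (x v : V).

Lemma is_derive_uniq f x v d d' :
  is_derive x v f d -> is_derive x v f d' -> d = d'.
Proof. by move=> [_ <-] [_ <-]. Qed.

Lemma is_derive_val f x v d d' : is_derive x v f d -> d = d' -> is_derive x v f d'.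
Proof. by move=> H <-. Qed.

Lemma is_derive_ext f g x v d : f =1 g -> is_derive x v f d -> is_derive x v g d.
Proof. by move=> /funext ->. Qed.

Lemma is_deriveC x v (c : R) : is_derive x v (fun=> c) 0.
Proof. exact: is_derive_cst. Qed.

Lemma is_derive_add f g x v df dg : is_derive x v f df -> is_derive x v g dg ->
  is_derive x v (fun y => f y + g y) (df + dg).
Proof. exact: is_deriveD. Qed.

Lemma is_derive_sub f g x v df dg : is_derive x v f df -> is_derive x v g dg ->
  is_derive x v (fun y => f y - g y) (df - dg).
Proof. exact: is_deriveB. Qed.

Lemma is_derive_opp f x v df : is_derive x v f df ->
  is_derive x v (fun y => - f y) (- df).
Proof. exact: is_deriveN. Qed.

Lemma is_derive_mul f g x v df dg : is_derive x v f df -> is_derive x v g dg ->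
  is_derive x v (fun y => f y * g y) (df * g x + f x * dg).
Proof.
move=> hf hg.
have H : is_derive x v (fun y => f y * g y) _ := is_deriveM hf hg.
apply: is_derive_val H _.
by rewrite /GRing.scale /= addrC [g x * _]mulrC.
Qed.

Lemma is_derive_cmul c f x v df : is_derive x v f df ->
  is_derive x v (fun y => c * f y) (c * df).
Proof.
move=> hf; apply: is_derive_val (is_derive_mul (is_deriveC x v c) hf) _.
by rewrite mul0r add0r.
Qed.

Lemma is_derive_mulc c f x v df : is_derive x v f df ->
  is_derive x v (fun y => f y * c) (df * c).
Proof.
move=> hf; apply: is_derive_val (is_derive_mul hf (is_deriveC x v c)) _.
by rewrite mulr0 addr0.
Qed.

Lemma is_derive_bigsum (I : Type) (r : seq I) (P : pred I) (F : I -> V -> R)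
    (dF : I -> R) x v : (forall i, is_derive x v (F i) (dF i)) ->
  is_derive x v (fun y => \sum_(i <- r | P i) F i y) (\sum_(i <- r | P i) dF i).
Proof.
move=> hF; elim: r => [|i r IH].
  by rewrite big_nil; apply: is_derive_ext (is_deriveC _ _ _) => y; rewrite big_nil.
rewrite big_cons; case: ifP => Pi.
  apply: is_derive_ext (is_derive_add (hF i) IH) => y.
  by rewrite big_cons Pi.
by apply: is_derive_ext IH => y; rewrite big_cons Pi.
Qed.

Lemma derivable_bigprod (I : Type) (r : seq I) (P : pred I) (F : I -> V -> R) x v :
  (forall i, derivable (F i) x v) ->
  derivable (fun y => \prod_(i <- r | P i) F i y) x v.
Proof.
move=> hF; elim: r => [|i r IH].
  have -> : (fun y => \prod_(i <- [::] | P i) F i y) = cst 1.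
    by apply/funext => y; rewrite big_nil.
  exact: derivable_cst.
have [Pi|Pi] := boolP (P i).
  have -> : (fun y => \prod_(i <- i :: r | P i) F i y) =
    F i * (fun y => \prod_(i <- r | P i) F i y).
    by apply/funext => y; rewrite big_cons Pi.
  exact: derivableM.
have -> : (fun y => \prod_(i <- i :: r | P i) F i y) =
   (fun y => \prod_(i <- r | P i) F i y); last exact: IH.
by apply/funext => y; rewrite big_cons (negPf Pi).
Qed.

Lemma derivable_det n (A : V -> 'M[R]_n) x v :
  (forall i j, derivable (fun y => A y i j) x v) ->
  derivable (fun y => \det (A y)) x v.
Proof.
move=> hA; rewrite /determinant.
pose F (s : 'S_n) y := (-1) ^+ s * \prod_i A y i (s i).
suff H s : is_derive x v (F s) ('D_v (F s) x).
  by have [] := @is_derive_bigsum _ (index_enum _) xpredT F _ x v H.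
apply: derivableP; rewrite /F.
apply: (@derivableM _ _ (cst ((-1) ^+ s)) (fun y => \prod_i A y i (s i))).
  exact: derivable_cst.
exact: (@derivable_bigprod _ _ _ (fun i y => A y i (s i))).
Qed.

End Derivatives.

(** A directional derivative only sees the restriction to one line, so it passes between functions
    on different spaces that agree along corresponding lines. This covers restriction to a segment
    and to slices of R x R^8. *)
Lemma is_derive_transport (R : realType) (V V' : normedModType R)
    (F : V -> R) (f : V' -> R) a w b v d :
  (forall h : R, F (h *: w + a) = f (h *: v + b)) ->
  is_derive b v f d -> is_derive a w F d.
Proof.
move=> Ff [f_der f_val].
have F0 : F a = f b by have := Ff 0; rewrite !scale0r !add0r.
have E : (fun h : R => h^-1 *: ((F \o shift a) (h *: w) - F a)) =
         (fun h : R => h^-1 *: ((f \o shift b) (h *: v) - f b)).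
  by apply/funext => h /=; rewrite Ff F0.
by split; rewrite /derivable /derive E.
Qed.

(** * Symmetry of second directional derivatives *)

Section Schwarz.
Variables (R : realType) (V : normedModType R).
Implicit Types (f : V -> R) (x u v : V).

Lemma directional_MVT f x v (s : R) : 0 < s -> (forall y, derivable f y v) ->
  exists2 c, 0 < c < s & f (s *: v + x) - f x = s * 'D_v f (c *: v + x).
Proof.
move=> s0 df; pose g (r : R) := f (r *: v + x).
have dg (r : R) : is_derive r 1 g ('D_v f (r *: v + x)).
  apply: (@is_derive_transport _ _ _ _ f _ _ (r *: v + x) v); last exact: derivableP.
  by move=> h; rewrite /g scalerDl addrA; congr (f (_ *: _ + _ + _)); rewrite /GRing.scale /= mulr1.
have cg : {within `[0, s], continuous g}%classic.
  apply: continuous_subspaceT => r.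
  by apply/differentiable_continuous/derivable1_diffP; have [] := dg r.
have [c cs E] := MVT s0 (fun r _ => dg r) cg.
exists c; first by move: cs; rewrite in_itv.
by move: E; rewrite /g scale0r add0r subr0 mulrC.
Qed.

(** The mean value theorem is applied along [u] to the difference of [f] in direction [v], and then
    along [v] to ['D_u f]. *)
Lemma second_difference f x u v (s t : R) : 0 < s -> 0 < t ->
  (forall y, derivable f y u) -> (forall y, derivable ('D_u f) y v) ->
  exists p, [/\ 0 < p.1 < s, 0 < p.2 < t &
    f (t *: v + (s *: u + x)) - f (s *: u + x) - (f (t *: v + x) - f x) =
    s * t * 'D_v ('D_u f) (p.2 *: v + (p.1 *: u + x))].
Proof.
move=> s0 t0 fu fuv; pose G y := f (t *: v + y) - f y.
have dG y : is_derive y u G ('D_u f (t *: v + y) - 'D_u f y).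
  apply: is_derive_sub; last exact: derivableP.
  apply: (@is_derive_transport _ _ _ _ f _ _ (t *: v + y) u); last exact: derivableP.
  by move=> h; rewrite addrCA.
have [c cs E] := @directional_MVT G x u s s0 (fun y => @ex_derive _ _ _ _ _ _ _ (dG y)).
have [d dt E'] := @directional_MVT ('D_u f) (c *: u + x) v t t0 fuv.
exists (c, d); split => //=.
have [_ DG] := dG (c *: u + x).
by rewrite -/(G (s *: u + x)) -/(G x) E DG E' mulrA.
Qed.

(** The second difference is symmetric in [u] and [v], so the two mixed derivatives agree at two
    points arbitrarily close to [x]; continuity excludes a gap [e] at [x]. *)
Lemma schwarz f x u v : Ck 2 f -> 'D_v ('D_u f) x = 'D_u ('D_v f) x.
Proof.
case=> _ f2; have [fu [_ fu2]] := f2 u; have [fv [_ fv2]] := f2 v.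
have [fuv [cuv _]] := fu2 v; have [fvu [cvu _]] := fv2 u.
apply/eqP; rewrite -subr_eq0; apply/negP => /negP; rewrite -normr_gt0.
set A := 'D_v ('D_u f) in cuv *; set B := 'D_u ('D_v f) in cvu *.
set e := `|_| => e0.
have e2 : 0 < e / 2 by rewrite divr_gt0.
have /cvgrPdist_lt/(_ _ e2)/nbhs_ballP[d1 /= d10 H1] := cuv x.
have /cvgrPdist_lt/(_ _ e2)/nbhs_ballP[d2 /= d20 H2] := cvu x.
pose d := Num.min d1 d2; have d0 : 0 < d by rewrite lt_min d10.
(* The added 1 keeps [n] positive even when [u] and [v] vanish; steps shorter than [s = d / n] stay
   within distance [d] of [x]. *)
pose n := `|u| + `|v| + 1.
have n0 : 0 < n by rewrite ltr_wpDl ?addr_ge0.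
pose s := d / n; have s0 : 0 < s by rewrite divr_gt0.
have near (a b : R) : 0 < a < s -> 0 < b < s -> `|x - (a *: u + (b *: v + x))| < d.
  move=> /andP[a0 as_] /andP[b0 bs].
  rewrite addrA opprD addrCA subrr addr0 normrN (le_lt_trans (ler_normD _ _))//.
  rewrite !normrZ !gtr0_norm//.
  have : a * `|u| <= s * `|u| by rewrite ler_wpM2r // ltW.
  have : b * `|v| <= s * `|v| by rewrite ler_wpM2r // ltW.
  have : s * n = d by rewrite /s divfK // gt_eqF.
  rewrite /n; lra.
have [[a b] /= [ha hb E1]] := second_difference x s0 s0 fu fuv.
have [[a' b'] /= [ha' hb' E2]] := second_difference x s0 s0 fv fvu.
have E : A (b *: v + (a *: u + x)) = B (b' *: u + (a' *: v + x)).
  have ss : s * s != 0 by rewrite mulf_neq0 // gt_eqF.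
  apply: (mulfI ss); rewrite -E1 -E2.
  by rewrite [s *: u + (s *: v + x)]addrCA; ring.
have N1 : `|A x - A (b *: v + (a *: u + x))| < e / 2.
  apply: H1; rewrite -ball_normE /= addrCA; apply: (lt_le_trans (near _ _ ha hb)).
  by rewrite ge_min lexx.
have N2 : `|B x - B (b' *: u + (a' *: v + x))| < e / 2.
  apply: H2; rewrite -ball_normE /=; apply: (lt_le_trans (near _ _ hb' ha')).
  by rewrite ge_min lexx orbT.
have eE : e = `|A x - B x| by [].
move: E N1 N2; rewrite eE; clear.
move: (A (b *: v + _)) (B (b' *: u + _)) => y z -> {y}.
move: (A x) (B x) => p q N1 N2.
have := ler_normB (p - z) (q - z); rewrite opprB addrA subrK. lra.
Qed.

End Schwarz.

Section MatrixDerivative.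
Variable R : realType.
Implicit Types (A B : R -> 'M[R]_8).

Definition mx_derive A (dA : 'M[R]_8) : Prop :=
  forall i j, is_derive (0 : R) (1 : R) (fun s => A s i j) (dA i j).

Lemma mx_derive_mul A B dA dB : mx_derive A dA -> mx_derive B dB ->
  mx_derive (fun s => A s *m B s) (dA *m B 0 + A 0 *m dB).
Proof.
move=> hA hB i j.
apply: is_derive_ext (fun s => esym (mxE _ _ _ _)) _.
apply: is_derive_val (is_derive_bigsum _ _ (fun k => is_derive_mul (hA i k) (hB k j))) _.
by rewrite big_split !mxE.
Qed.

Lemma mx_derive_tr A dA : mx_derive A dA ->
  is_derive (0 : R) (1 : R) (fun s => \tr (A s)) (\tr dA).
Proof. by move=> hA; apply: is_derive_bigsum => i. Qed.

Lemma mx_derive_uniq A dA dA' : mx_derive A dA -> mx_derive A dA' -> dA = dA'.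
Proof.
by move=> h h'; apply/matrixP => i j; exact: is_derive_uniq (h i j) (h' i j).
Qed.

(** Cramer's formula shows that the entries of the inverse are differentiable; the product rule for
    [A *m K = 1] then gives the value. *)
Lemma mx_derive_inv A dA : (forall s, A s \in unitmx) -> A 0 = 1%:M ->
  mx_derive A dA -> mx_derive (fun s => invmx (A s)) (- dA).
Proof.
move=> uA A0 hA; pose K s := invmx (A s).
have dd : derivable (fun s => \det (A s)) (0 : R) (1 : R).
  by apply: derivable_det => i j; have [] := hA i j.
have dK i j : derivable (fun s => K s i j) (0 : R) (1 : R).
  have -> : (fun s => K s i j) =
     (fun s => (\det (A s))^-1) * (cst ((-1) ^+ (j + i)) *
       (fun s => \det (row' j (col' i (A s))))).
    by apply/funext => s; rewrite /K /invmx uA !mxE.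
  apply: derivableM; first by apply: derivableV => //; rewrite A0 det1 oner_neq0.
  apply: derivableM; first exact: derivable_cst.
  apply: derivable_det => k l.
  have -> : (fun y => row' j (col' i (A y)) k l) = (fun y => A y (lift j k) (lift i l)).
    by apply/funext => y; rewrite !mxE.
  by have [] := hA (lift j k) (lift i l).
pose dKm : 'M[R]_8 := \matrix_(i, j) 'D_1 (fun s => K s i j) 0.
have hK : mx_derive K dKm by move=> i j; rewrite mxE; exact: derivableP.
have h1 : mx_derive (fun s => A s *m K s) 0.
  move=> i j; rewrite mxE; apply: is_derive_ext (is_deriveC _ _ ((1%:M : 'M[R]_8) i j)).
  by move=> s; rewrite /K mulmxV.
have := mx_derive_uniq (mx_derive_mul hA hK) h1.
rewrite /K A0 invmx1 mulmx1 mul1mx => /eqP.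
by rewrite addrC addr_eq0 => /eqP <-.
Qed.

End MatrixDerivative.

Section CayleyVariation.
Variables (R : realType) (P : R -> tensor4 R) (G : R -> 'M[R]_8).
Variables (phi : tensor4 R) (gamma : 'M[R]_8).
Hypotheses (fP : forall s, is_form4 (P s)) (GT : forall s, (G s)^T = G s).
Hypotheses (uG : forall s, G s \in unitmx) (cid : forall s, cayley_identity (G s) (P s)).
Hypothesis dP : forall a b c d, is_derive (0 : R) (1 : R) (fun s => P s a b c d) (phi a b c d).
Hypotheses (dG : mx_derive G gamma) (G0 : G 0 = 1%:M).
Local Notation eta := (1%:M : 'M[R]_8).

(** Derivative at the identity of the contraction with the identity matrix, in which the inverse
    metric occurs only once. On the right [12 = 16 - 2 - 2] and [30 = 56 - 32 + 6]. *)
Lemma cayley_contr_derive i a :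
  \sum_j \sum_k \sum_p (phi i j k p * P 0 a j k p + P 0 i j k p * phi a j k p)
  - \sum_j \sum_k \sum_p \sum_q P 0 i j k p * gamma p q * P 0 a j k q
  = 12 * \tr gamma * eta i a + 30 * gamma i a.
Proof.
have dK := mx_derive_inv uG G0 dG.
have D : is_derive (0 : R) (1 : R)
    (fun s => \sum_j \sum_k \sum_p \sum_q P s i j k p * invmx (G s) p q * P s a j k q)
    (\sum_j \sum_k \sum_p \sum_q
      ((phi i j k p * invmx (G 0) p q + P 0 i j k p * (- gamma) p q) * P 0 a j k q
       + P 0 i j k p * invmx (G 0) p q * phi a j k q)).
  do 4![apply: is_derive_bigsum => ?].
  by apply: is_derive_mul => //; apply: is_derive_mul => //; exact: dK.
have dtr := mx_derive_tr dG.
have d2 := mx_derive_mul dG dG; have d3 := mx_derive_mul d2 dG.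
have D' := is_derive_add (is_derive_sub
  (is_derive_mul (is_derive_sub (is_derive_mul dtr dtr) (mx_derive_tr d2)) (dG i a))
  (is_derive_mul (is_derive_cmul 2 dtr) (d2 i a))) (is_derive_cmul 2 (d3 i a)).
have {D D'} E := is_derive_uniq D (is_derive_ext (fun s =>
  esym (cayley_contr_delta (GT s) (fP s) (@cid s) i a)) D').
transitivity (\sum_j \sum_k \sum_p \sum_q
      ((phi i j k p * invmx (G 0) p q + P 0 i j k p * (- gamma) p q) * P 0 a j k q
       + P 0 i j k p * invmx (G 0) p q * phi a j k q)).
  rewrite -sumrB; apply: eq_bigr => j _; rewrite -sumrB; apply: eq_bigr => k _.
  rewrite -sumrB; apply: eq_bigr => p _; rewrite G0 invmx1.
  transitivity (\sum_q (eta p q * (phi i j k p * P 0 a j k q + P 0 i j k p * phi a j k q)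
     - P 0 i j k p * gamma p q * P 0 a j k q)).
    by rewrite sumrB sum_mx1l.
  by apply: eq_bigr => q _; rewrite [(- gamma) p q]mxE; ring.
have addE (A B : 'M[R]_8) k l : (A + B) k l = A k l + B k l by rewrite mxE.
rewrite {}E /= G0 !(mulmx1, mul1mx) !linearD /= mxtrace1 !addE.
by lra.
Qed.

End CayleyVariation.

Section TimeSlices.
Variable R : realType.
Implicit Types (F : R * 'rV[R]_8 -> R) (x : 'rV[R]_8).

Lemma is_derive_space_slice F s x v : derivable F (s, x) (0, v) ->
  is_derive x v (fun y => F (s, y)) ('D_(0, v) F (s, x)).
Proof.
move=> dF; apply: is_derive_transport (derivableP dF) => h.
by congr F; congr pair; rewrite /= scaler0 add0r.
Qed.

Lemma is_derive_time_slice F s x : derivable F (s, x) (1, 0) ->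
  is_derive s (1 : R) (fun r => F (r, x)) ('D_(1, 0) F (s, x)).
Proof.
move=> dF; apply: is_derive_transport (derivableP dF) => h.
by congr F; congr pair; rewrite /= scaler0 add0r.
Qed.

(** Both derivatives are directional derivatives on R x R^8, along [(1, 0)] and [(0, e_i)], and are
    exchanged by [schwarz]. *)
Lemma is_derive_pd_time F (d : 'rV[R]_8 -> R) i x : smooth F ->
  (forall y, is_derive (0 : R) (1 : R) (fun s => F (s, y)) (d y)) ->
  is_derive (0 : R) (1 : R) (fun s => pd i (fun y => F (s, y)) x) (pd i d x).
Proof.
move=> sF dF; have [_ F1] := sF 1%N; have [_ F2] := sF 2%N.
pose e : R * 'rV[R]_8 := (0, delta_mx 0 i); pose o : R * 'rV[R]_8 := (1, 0).
have dE y : d y = 'D_o F (0, y).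
  by apply: is_derive_uniq (dF y) (is_derive_time_slice _); exact: (F1 o).1.
have pdE s : pd i (fun y => F (s, y)) x = 'D_e F (s, x).
  by have [_ H] := is_derive_space_slice ((F1 e).1 (s, x)); exact: H.
apply: is_derive_ext (fun s => esym (pdE s)) _.
have [_ [_ He]] := F2 e.
apply: is_derive_val (is_derive_time_slice ((He o).1 (0, x))) _.
rewrite (schwarz _ _ _ (sF 2%N)) (funext dE).
have [_ [_ H]] := F2 o.
by have [_ H'] := is_derive_space_slice ((H e).1 (0, x)); rewrite -H'.
Qed.

End TimeSlices.

(** * First-order variation of the torsion *)

Section MetricOf.
Variables (R : realType) (Phi : tensor4 R) (g : 'M[R]_8).
Hypothesis mg : metric_of Phi g.

Lemma metric_of_unit : g \in unitmx.
Proof.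
case: mg => _ pos _ _; rewrite unitmxE unitfE; apply/negP => /det0P[v v0 vg].
by have := pos v v0; rewrite vg mul0mx mxE ltxx.
Qed.

Lemma metric_of_trace_gt0 : 0 < \tr g.
Proof.
case: mg => _ pos _ _.
have gii i : 0 < g i i.
  have := pos (delta_mx 0 i); rewrite -rowE trmx_delta -colE !mxE; apply.
  by apply/eqP => /matrixP/(_ 0 i)/eqP; rewrite !mxE !eqxx oner_eq0.
rewrite /mxtrace (bigD1 ord0) //= ltr_pwDl // sumr_ge0 // => i _; exact: ltW.
Qed.

Lemma metric_of_uniq : is_form4 Phi -> metric_of Phi 1%:M -> g = 1%:M.
Proof.
move=> fPhi [_ _ cid1 _]; have [gT _ cid _] := mg.
exact: metric_uniqueness fPhi cid1 cid gT metric_of_unit metric_of_trace_gt0.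
Qed.

End MetricOf.

(** Moving [p] from the last slot of [Phi] to the first takes three transpositions; the resulting
    sign cancels that of the factor [- 4]. *)
Lemma perturbationE (R : realType) (Phi : tensor4 R) (h xi : 'rV[R]_8 -> 'M[R]_8)
    x a b c d : is_form4 Phi ->
  perturbation Phi h xi x a b c d =
  act (fun a p => h x a p + 4^-1 * xi x a p) Phi a b c d.
Proof.
move=> fPhi; rewrite -alt4_act // /perturbation.
have -> : (fun a b c d => \sum_p (h x a p + 4^-1 * xi x a p) * Phi b c d p) =
    (fun a b c d => - \sum_p (h x a p + 4^-1 * xi x a p) * Phi p b c d).
  apply/funext => a'; apply/funext => b'; apply/funext => c'; apply/funext => d'.
  rewrite -sumrN; apply: eq_bigr => p _.
  rewrite (form4_34 fPhi b' c' p d') (form4_23 fPhi b' p c' d').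
  by rewrite (form4_12 fPhi p b' c' d'); ring.
rewrite !alt4E; ring.
Qed.

Section LinearDerivatives.
Variables (R : realType) (V : normedModType R) (x v : V).

Lemma is_derive_act (M : V -> 'I_8 -> 'I_8 -> R) dM (Phi : tensor4 R) a b c d :
  (forall i j, is_derive x v (fun y => M y i j) (dM i j)) ->
  is_derive x v (fun y => act (M y) Phi a b c d) (act dM Phi a b c d).
Proof.
move=> hM; have H i (w : 'I_8 -> R) :
    is_derive x v (fun y => \sum_p M y i p * w p) (\sum_p dM i p * w p).
  by apply: is_derive_bigsum => p; apply: is_derive_mulc.
exact: is_derive_add (is_derive_add (is_derive_add (H a _) (H b _)) (H c _)) (H d _).
Qed.

Lemma is_derive_alt4 (X : V -> tensor4 R) dX a b c d :
  (forall a b c d, is_derive x v (fun y => X y a b c d) (dX a b c d)) ->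
  is_derive x v (fun y => alt4 (X y) a b c d) (alt4 dX a b c d).
Proof.
move=> hX; apply: is_derive_cmul; apply: is_derive_bigsum => s.
by apply: is_derive_cmul; exact: hX.
Qed.

End LinearDerivatives.

Lemma pd_derivable (R : realType) (f : 'rV[R]_8 -> R) i x : smooth f ->
  is_derive x (delta_mx 0 i) f (pd i f x).
Proof. by move=> sf; apply: derivableP; have [_ H] := sf 1%N; exact: (H _).1. Qed.

(** Vanishing action forces [A = 0]. The formulas for [A^2] and [v^2] are independent in [T2] and
    [Q], so [T2 = 0], a sum of squares. *)
Lemma flat_torsion_eq0 (R : realType) (Phi : tensor4 R) (t : tensor3 R) :
    is_form4 Phi -> cayley_identity 1%:M Phi -> is_form3 t ->
    (forall i a b c d, act (t i) Phi a b c d = 0) ->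
  forall i a b, t i a b = 0.
Proof.
move=> fPhi cid ft t0.
have A0 i a b : four_proj7 Phi (t i) a b = 0.
  by apply: act_eq0_four_proj7 => // a' b'; have [_] := ft i a' b'.
have := torsion_norm_sq fPhi cid ft; have := torsion_trace_sq fPhi cid ft.
rewrite big1 => [|p _]; last by rewrite big1 ?expr0n.
rewrite [X in X = 4 * _ - _]big1 => [|i _]; last first.
  by rewrite /dot2 big1 // => a _; rewrite big1 // => b _; rewrite A0 mul0r.
set T2 := \sum_i dot2 (t i) (t i) => e1 e2.
have T20 : T2 = 0 by lra.
move=> i a b; apply/eqP; rewrite -sqrf_eq0.
have ge0 j c d : 0 <= t j c d * t j c d by rewrite -expr2 sqr_ge0.
move/eqP: T20; rewrite psumr_eq0 => [|j _]; last by do 2!apply: sumr_ge0 => ? _.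
move/allP/(_ i (mem_index_enum _)); rewrite /= psumr_eq0 => [|j _]; last exact: sumr_ge0.
move/allP/(_ a (mem_index_enum _)); rewrite /= psumr_eq0 => [|j _]; last by [].
by move/allP/(_ b (mem_index_enum _)).
Qed.

Section TorsionVariation.
Variables (R : realType) (Phi : tensor4 R) (h xi : 'rV[R]_8 -> 'M[R]_8).
Variable t : 'rV[R]_8 -> tensor3 R.
Hypotheses (fPhi : is_form4 Phi) (mPhi : metric_of Phi 1%:M).
Hypotheses (sh : forall a b, smooth (fun x => h x a b)).
Hypotheses (sxi : forall a b, smooth (fun x => xi x a b)).
Hypotheses (hT : forall x, (h x)^T = h x) (xiT : forall x, (xi x)^T = - xi x).
Hypothesis tv : torsion_variation Phi (perturbation Phi h xi) t.
Local Notation eta := (1%:M : 'M[R]_8).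

Lemma torsion_variation_form3 x : is_form3 (t x).
Proof.
case: tv => Ps [gs [Ts [_ [_ [_ [tors [_ [_ dT]]]]]]]] a b c.
have neg u w (d d' : R) : is_derive (0 : R) (1 : R) u d ->
  is_derive (0 : R) (1 : R) w d' -> (forall s : R, w s = - u s) -> d' = - d.
  move=> hu hw E; apply: is_derive_uniq hw _.
  by apply: is_derive_ext (is_derive_opp hu) => s; rewrite E.
by split; [apply: (neg _ _ _ _ (dT x a b c) (dT x b a c))
  |apply: (neg _ _ _ _ (dT x a b c) (dT x a c b))] => s;
  have [f3 _] := tors s x; have [] := f3 a b c.
Qed.

Definition torsion_source x i a p : R :=
  4^-1 * d1 xi i a p x + d1 h p a i x - d1 h a p i x.

Lemma d1_sym i a b x : d1 h i b a x = d1 h i a b x.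
Proof. by rewrite /d1; congr (pd i _ x); apply/funext => y; rewrite -[in LHS]hT mxE. Qed.

Lemma d1_anti i a b x : d1 xi i b a x = - d1 xi i a b x.
Proof.
have H := is_derive_opp (pd_derivable i x (sxi a b)).
apply: is_derive_uniq (pd_derivable i x (sxi b a)) _.
by apply: is_derive_ext H => y; rewrite -[in RHS](opprK (xi y)) -xiT !mxE.
Qed.

Lemma torsion_source_anti x i a p : torsion_source x i p a = - torsion_source x i a p.
Proof. by rewrite /torsion_source d1_anti; ring. Qed.

Lemma torsion_variation_proj7 x i a p :
  four_proj7 Phi (t x i) a p = four_proj7 Phi (torsion_source x i) a p.
Proof.
have ft := torsion_variation_form3 x.
case: tv => Ps [gs [Ts [sP [sg [cm [tors [P0 [dP dT]]]]]]]].
have fP s y : is_form4 (Ps s y) := cayley_form_is_form4 (cm s y).1.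
(* The family supplies some metric of [Phi] at [s = 0]; uniqueness identifies it with the flat
   one. *)
have g0 y : gs 0 y = 1%:M.
  by apply: metric_of_uniq fPhi mPhi; rewrite -(P0 y); exact: (cm 0 y).2.
have [_ _ cid1 _] := mPhi.
have gT s y : (gs s y)^T = gs s y by have [_ []] := cm s y.
have gcid s y : cayley_identity (gs s y) (Ps s y) by have [_ []] := cm s y.
have gu s y : gs s y \in unitmx by apply: metric_of_unit (cm s y).2.
pose gam y : 'M[R]_8 := \matrix_(a, b) 'D_1 (fun s : R => gs s y a b) 0.
have dg y : mx_derive (fun s => gs s y) (gam y).
  move=> k l; rewrite mxE; have [_ H] := sg k l 1%N.
  by have [H' _] := is_derive_time_slice ((H (1, 0)).1 (0, y)); exact: derivableP.
have gamE y : gam y = 2 *: h y.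
  apply: (@linearised_metric _ Phi fPhi cid1 (h y) (4^-1 *: xi y)) => //.
  - by rewrite linearZ /= xiT scalerN.
  - apply/matrixP => k l; rewrite !mxE.
    suff -> : (fun s => gs s y l k) = (fun s => gs s y k l) by [].
    by apply/funext => s; rewrite -[in LHS]gT mxE.
  move=> k l; have := cayley_contr_derive (fP ^~ y) (gT ^~ y) (gu ^~ y)
    (gcid ^~ y) (dP y) (dg y) (g0 y) k l.
  rewrite P0 => <-; congr (_ - _); do 3!(apply: eq_bigr => ? _).
  have E : fun_of_matrix (h y + 4^-1 *: xi y) =
      (fun a p => h y a p + 4^-1 * xi y a p).
    by apply/funext => ?; apply/funext => ?; rewrite !mxE.
  by rewrite E !perturbationE.
have dK y := mx_derive_inv (gu ^~ y) (g0 y) (dg y).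
have pd0 j k l : pd j (fun y => gs 0 y k l) x = 0.
  have -> : (fun y => gs 0 y k l) = cst (eta k l) by apply/funext => y; rewrite g0.
  exact: derive_cst.
have dpd j k l : is_derive (0 : R) (1 : R) (fun s => pd j (fun y => gs s y k l) x)
    (2 * d1 h j k l x).
  have dgE y : is_derive (0 : R) (1 : R) (fun s => gs s y k l) (2 * h y k l).
    by apply: is_derive_val (dg y k l) _; rewrite gamE mxE.
  have := is_derive_pd_time (d := fun y => 2 * h y k l) j x (sg k l) dgE.
  move=> H; apply: is_derive_val H _.
  by have [_ H] := is_derive_cmul 2 (pd_derivable j x (sh k l)); rewrite -H.
have Gamma0 p' i' j' : christoffel (gs 0) x p' i' j' = 0.
  by rewrite /christoffel big1 ?mulr0 // => q _; rewrite !pd0 addr0 subrr mulr0.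
have dGamma p' i' j' : is_derive (0 : R) (1 : R) (fun s => christoffel (gs s) x p' i' j')
    (d1 h i' p' j' x + d1 h j' p' i' x - d1 h p' i' j' x).
  have H := is_derive_cmul 2^-1 (is_derive_bigsum (index_enum _) xpredT (fun q =>
    is_derive_mul (dK x p' q) (is_derive_sub
      (is_derive_add (dpd i' q j') (dpd j' q i')) (dpd q i' j')))).
  apply: is_derive_val H _.
  transitivity (2^-1 * \sum_q eta p' q * (2 * d1 h i' q j' x + 2 * d1 h j' q i' x
     - 2 * d1 h q i' j' x)); last by rewrite sum_mx1l; field.
  congr (_ * _); apply: eq_bigr => q _ /=.
  by rewrite !pd0 addr0 subrr mulr0 add0r g0 invmx1.
(* [dM i] is the derivative of the matrix acting in [phi], and [dC i] the linearised Christoffel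
   symbol with its upper index written last. Their difference is [torsion_source]. *)
pose dM i a p := d1 h i a p x + 4^-1 * d1 xi i a p x.
pose dC i a p := d1 h i p a x + d1 h a p i x - d1 h p i a x.
have dphi i' a' b' c' d' : pd i' (fun y => perturbation Phi h xi y a' b' c' d') x =
    act (dM i') Phi a' b' c' d'.
  have H : is_derive x (delta_mx 0 i') (fun y => perturbation Phi h xi y a' b' c' d')
     (act (dM i') Phi a' b' c' d'); last by have [_ <-] := H.
  apply: is_derive_ext (fun y => esym (perturbationE _ _ _ _ _ _ _ fPhi)) _.
  apply: is_derive_act => k l; apply: is_derive_add (pd_derivable _ _ _) _ => //.
  exact: is_derive_cmul (pd_derivable _ _ _).
have dnabla i' a' b' c' d' : is_derive (0 : R) (1 : R)
    (fun s => nabla (gs s) (Ps s) x i' a' b' c' d')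
    (act (dM i') Phi a' b' c' d' - act (dC i') Phi a' b' c' d').
  have H1 := is_derive_pd_time (d := fun y => perturbation Phi h xi y a' b' c' d')
    i' x (sP a' b' c' d') (fun y => dP y a' b' c' d').
  (* The Christoffel symbols vanish at [s = 0], so the variation of [Phi] does not enter these
     products. *)
  have H2 k (u : 'I_8 -> 'I_8) (F : R -> 'I_8 -> R) dF :
      (forall p, is_derive (0 : R) (1 : R) (F ^~ p) (dF p)) -> 
      forall p, is_derive (0 : R) (1 : R) (fun s => christoffel (gs s) x p i' k * F s p)
        (dC i' k p * F 0 p).
    move=> hF p'; apply: is_derive_val (is_derive_mul (dGamma _ _ _) (hF p')) _.
    by rewrite Gamma0 mul0r addr0.
  have H3 := is_derive_sub H1 (is_derive_bigsum (index_enum _) xpredT (fun p =>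
    is_derive_add (is_derive_add (is_derive_add
      (H2 a' id (fun s p => Ps s x p b' c' d') _ (fun p => dP x p b' c' d') p)
      (H2 b' id (fun s p => Ps s x a' p c' d') _ (fun p => dP x a' p c' d') p))
      (H2 c' id (fun s p => Ps s x a' b' p d') _ (fun p => dP x a' b' p d') p))
      (H2 d' id (fun s p => Ps s x a' b' c' p) _ (fun p => dP x a' b' c' p) p))).
  by apply: is_derive_val H3 _; rewrite dphi /= P0 !big_split.
(* Once the torsion vanishes at [s = 0], differentiating its product with the inverse metric and
   [Phi] leaves only [t]. *)
have T0 : forall i a b, Ts 0 x i a b = 0.
  have [f3 tor0] := tors 0 x.
  apply: flat_torsion_eq0 fPhi cid1 f3 _ => i' a' b' c' d'.
  rewrite -alt4_act //; transitivity (nabla (gs 0) (Ps 0) x i' a' b' c' d').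
    rewrite tor0; congr (4 * alt4 _ a' b' c' d').
    apply/funext => k; apply/funext => l; apply/funext => m; apply/funext => n.
    apply: eq_bigr => p' _ /=; rewrite g0 invmx1 P0.
    by rewrite -mulr_suml sum_mx1rC.
  rewrite /nabla big1 => [|p' _]; last by rewrite !Gamma0 !mul0r !addr0.
  have -> : (fun y => Ps 0 y a' b' c' d') = cst (Phi a' b' c' d').
    by apply/funext => y; rewrite P0.
  by rewrite /pd derive_cst subr0.
have main a' b' c' d' :
    act (dM i) Phi a' b' c' d' - act (dC i) Phi a' b' c' d' =
    act (t x i) Phi a' b' c' d'.
  rewrite -[RHS]alt4_act //.
  apply: is_derive_uniq (dnabla i a' b' c' d') _.
  apply: is_derive_ext (fun s => esym ((tors s x).2 i a' b' c' d')) _.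
  apply: is_derive_cmul; apply: is_derive_alt4 => k l m n.
  apply: is_derive_bigsum => p'.
  have H := is_derive_bigsum (index_enum _) xpredT (fun q =>
    is_derive_mul (is_derive_mul (dT x i k q) (dK x q p')) (dP x p' l m n)).
  apply: is_derive_val H _; rewrite /= g0 invmx1 P0.
  rewrite -[t x i k p'](sum_mx1rC (t x i k)) mulr_suml; apply: eq_bigr => q _.
  by rewrite !T0 !mul0r !addr0.
have zero a' b' c' d' :
    act (fun a p => torsion_source x i a p - t x i a p) Phi a' b' c' d' = 0.
  rewrite actB -main -actB.
  suff -> : torsion_source x i = (fun a p => dM i a p - dC i a p) by rewrite subrr.
  apply/funext => k; apply/funext => l.
  rewrite /torsion_source /dM /dC (d1_sym i k l) (d1_sym l k i); ring.
apply/esym/eqP; rewrite -subr_eq0 -four_proj7B; apply/eqP.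
apply: act_eq0_four_proj7 => // k l; rewrite torsion_source_anti.
have [_ ->] := ft i k l; ring.
Qed.

End TorsionVariation.

(** * The linearised Lagrangian modulo divergences *)

Section TotalDerivatives.
Variable R : realType.
Local Notation field2 := ('rV[R]_8 -> 'M[R]_8).
Implicit Types (F : field2 -> field2 -> 'rV[R]_8 -> R) (h xi u : field2).

Definition smooth2 u : Prop := forall a b, smooth (fun x => u x a b).

Definition total_derivative F : Prop :=
  exists C, forall h xi, smooth2 h -> smooth2 xi ->
    forall x, F h xi x = \sum_a pd a (current C h xi a) x.

Definition divergence_term a k (I J : bool * 'I_8 * 'I_8) h xi x : R :=
  pd a (component h xi I) x * pd k (component h xi J) x
  + component h xi I x * pd a (pd k (component h xi J)) x.

(** The divergence of the current with [u_I d_k u_J] in slot [a] and minus [u_I d_a u_J] in slot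
    [k]: the second derivatives cancel. Adding it to a Lagrangian exchanges the two derivatives in a
    product. *)
Definition null_lagrangian a k (I J : bool * 'I_8 * 'I_8) h xi x : R :=
  pd a (component h xi I) x * pd k (component h xi J) x
  - pd k (component h xi I) x * pd a (component h xi J) x.

Lemma component_smooth h xi I : smooth2 h -> smooth2 xi -> smooth (component h xi I).
Proof. by move=> sh sxi; case: I => [[[] a] b]; [exact: sxi | exact: sh]. Qed.

Lemma div_currentE C h xi x : smooth2 h -> smooth2 xi ->
  \sum_a pd a (current C h xi a) x =
  \sum_a \sum_k \sum_I \sum_J C a k I J * divergence_term a k I J h xi x.
Proof.
move=> sh sxi; apply: eq_bigr => a _; have sc I := component_smooth I sh sxi.
have D : is_derive x (delta_mx 0 a) (current C h xi a)
    (\sum_k \sum_I \sum_J C a k I J * divergence_term a k I J h xi x).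
  do 3![apply: is_derive_bigsum => ?].
  have H2 k J : is_derive x (delta_mx 0 a) (pd k (component h xi J))
      (pd a (pd k (component h xi J)) x).
    have [_ H] := sc J 2%N; have [_ [_ H']] := H (delta_mx 0 k).
    by apply: derivableP; exact: (H' _).1.
  apply: is_derive_val (is_derive_mul (is_derive_cmul _ (pd_derivable _ _ (sc _)))
     (H2 _ _)) _.
  by rewrite /divergence_term mulrDr !mulrA.
by have [_ <-] := D.
Qed.

Lemma total_derivative_ext F G :
  (forall h xi x, smooth2 h -> smooth2 xi -> F h xi x = G h xi x) ->
  total_derivative F -> total_derivative G.
Proof. by move=> FG [C HC]; exists C => h xi sh sxi x; rewrite -FG // HC. Qed.

(** In the expanded form the divergence is visibly linear in the coefficients [C], which gives
    closure under linear combinations. *)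
Lemma total_derivativeP F C :
  (forall h xi x, smooth2 h -> smooth2 xi -> F h xi x =
     \sum_a \sum_k \sum_I \sum_J C a k I J * divergence_term a k I J h xi x) ->
  total_derivative F.
Proof. by move=> H; exists C => h xi sh sxi x; rewrite div_currentE // H. Qed.

Lemma total_derivativeD F G : total_derivative F -> total_derivative G ->
  total_derivative (fun h xi x => F h xi x + G h xi x).
Proof.
case=> C HC [D HD]; apply: (@total_derivativeP _ (fun a k I J => C a k I J + D a k I J)).
move=> h xi x sh sxi; rewrite HC // HD // !div_currentE //.
do 4![rewrite -big_split; apply: eq_bigr => ? _ /=]; ring.
Qed.

Lemma total_derivativeZ c F : total_derivative F ->
  total_derivative (fun h xi x => c * F h xi x).
Proof.
case=> C HC; apply: (@total_derivativeP _ (fun a k I J => c * C a k I J)).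
move=> h xi x sh sxi; rewrite HC // div_currentE //.
do 4![rewrite mulr_sumr; apply: eq_bigr => ? _ /=]; ring.
Qed.

Lemma total_derivativeB F G : total_derivative F -> total_derivative G ->
  total_derivative (fun h xi x => F h xi x - G h xi x).
Proof.
move=> hF hG; apply: total_derivative_ext (total_derivativeD hF (total_derivativeZ (-1) hG)).
by move=> h xi x _ _; rewrite mulN1r.
Qed.

Lemma total_derivative_sum (T : finType) (F : T -> field2 -> field2 -> 'rV[R]_8 -> R) :
  (forall i, total_derivative (F i)) ->
  total_derivative (fun h xi x => \sum_i F i h xi x).
Proof.
move=> hF; elim: (index_enum T) => [|i r IH].
  apply: (@total_derivativeP _ (fun _ _ _ _ => 0)) => h xi x _ _.
  by rewrite big_nil; do 4!rewrite big1 // => ? _; rewrite mul0r.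
apply: total_derivative_ext (total_derivativeD (hF i) IH) => h xi x _ _.
by rewrite big_cons.
Qed.

Lemma sum_indicator (T : finType) (f : T -> R) j : \sum_i (i == j)%:R * f i = f j.
Proof.
rewrite (bigD1 j) //= eqxx mul1r big1 ?addr0 // => i /negPf ->; exact: mul0r.
Qed.

Lemma total_derivative_term a k I J : total_derivative (divergence_term a k I J).
Proof.
apply: (@total_derivativeP _ (fun a' k' I' J' =>
  (a' == a)%:R * ((k' == k)%:R * ((I' == I)%:R * (J' == J)%:R)))) => h xi x _ _.
symmetry; transitivity (\sum_a' (a' == a)%:R * \sum_k' (k' == k)%:R *
   \sum_I' (I' == I)%:R * \sum_J' (J' == J)%:R * divergence_term a' k' I' J' h xi x).
  apply: eq_bigr => a' _; rewrite mulr_sumr; apply: eq_bigr => k' _.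
  rewrite !mulr_sumr; apply: eq_bigr => I' _.
  by rewrite !mulr_sumr; apply: eq_bigr => J' _; rewrite !mulrA.
by rewrite !sum_indicator.
Qed.

Lemma total_derivative_null a k I J : total_derivative (null_lagrangian a k I J).
Proof.
apply: total_derivative_ext (total_derivativeB (total_derivative_term a k I J)
  (total_derivative_term k a I J)) => h xi x sh sxi.
rewrite /divergence_term /null_lagrangian.
have -> : pd k (pd a (component h xi J)) x = pd a (pd k (component h xi J)) x.
  exact: schwarz (component_smooth J sh sxi 2%N).
ring.
Qed.

Definition null_dxi_dh h xi x : R :=
  \sum_i \sum_a \sum_p null_lagrangian i p (true, a, p) (false, a, i) h xi x.

Definition null_dh_dh h xi x : R :=
  \sum_p \sum_a \sum_i null_lagrangian p a (false, a, i) (false, p, i) h xi x.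

Definition null_Phi_dh_dh (Phi : tensor4 R) h xi x : R :=
  \sum_i \sum_a \sum_p \sum_c \sum_d
    Phi a p c d * null_lagrangian p d (false, a, i) (false, c, i) h xi x.

Definition null_dxi_dtr h xi x : R :=
  \sum_a \sum_p \sum_c null_lagrangian a p (true, a, p) (false, c, c) h xi x.

Definition div_tr_h h xi x : R :=
  \sum_a \sum_b \sum_c divergence_term a b (false, c, c) (false, a, b) h xi x.

Definition null_dxi_dxi h xi x : R :=
  \sum_a \sum_c \sum_e null_lagrangian c a (true, a, e) (true, c, e) h xi x.

(** The combination collects the remainders of [source_norm_sq] and [source_trace_sq], weighted as
    in [action_density_flat]. [Phi] is constant, so it may enter the coefficients of the current. *)
Lemma total_derivative_boundary (kappa : R) (Phi : tensor4 R) :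
  total_derivative (fun h xi x =>
    36^-1 * (3 / 8 * (6 + kappa) *
        (16 * null_dxi_dh h xi x - 8 * null_dh_dh h xi x - 4 * null_Phi_dh_dh Phi h xi x)
      - (6 - 3 * kappa) *
        (null_dxi_dtr h xi x - 2 * div_tr_h h xi x - 2^-1 * null_dxi_dxi h xi x))).
Proof.
have Nsum (F : 'I_8 -> 'I_8 -> 'I_8 -> _) :
    (forall i j k, total_derivative (F i j k)) ->
    total_derivative (fun h xi x => \sum_i \sum_j \sum_k F i j k h xi x).
  move=> hF; apply: (@total_derivative_sum _ (fun i h xi x => _)) => i.
  apply: (@total_derivative_sum _ (fun j h xi x => _)) => j.
  by apply: (@total_derivative_sum _ (fun k h xi x => _)) => k.
apply: total_derivativeZ; apply: total_derivativeB.
  apply: total_derivativeZ; apply: total_derivativeB.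
    by apply: total_derivativeB; apply: total_derivativeZ;
      apply: Nsum => *; exact: total_derivative_null.
  apply: total_derivativeZ; apply: Nsum => i a p.
  apply: (@total_derivative_sum _ (fun c h xi x => _)) => c.
  apply: (@total_derivative_sum _ (fun d h xi x => _)) => d.
  by apply: total_derivativeZ; exact: total_derivative_null.
apply: total_derivativeZ; apply: total_derivativeB.
  apply: total_derivativeB; first by apply: Nsum => *; exact: total_derivative_null.
  by apply: total_derivativeZ; apply: Nsum => *; exact: total_derivative_term.
by apply: total_derivativeZ; apply: Nsum => *; exact: total_derivative_null.
Qed.

End TotalDerivatives.

(** * The two squares in terms of the first derivatives of h and xi *)

Section LinearisedAction.
Variables (R : realType) (Phi : tensor4 R).
Hypotheses (fPhi : is_form4 Phi) (cid : cayley_identity 1%:M Phi).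
Variables (h xi : 'rV[R]_8 -> 'M[R]_8).
Hypotheses (sh : smooth2 h) (sxi : smooth2 xi).
Hypotheses (hT : forall x, (h x)^T = h x) (xi7 : forall x, in_Lambda27 1%:M Phi (xi x)).
Variable x : 'rV[R]_8.
Local Notation eta := (1%:M : 'M[R]_8).

Let hC i a b : d1 h i b a x = d1 h i a b x.
Proof. exact: d1_sym. Qed.

Let xiN i a b : d1 xi i b a x = - d1 xi i a b x.
Proof. by apply: d1_anti => // y; have [] := xi7 y. Qed.

Let dxi i a b := d1 xi i a b x.
Let n i a p := d1 h p a i x - d1 h a p i x.

Lemma d1_xi_Lambda27 i a b : form_apply Phi (dxi i) a b = - 6 * dxi i a b.
Proof.
have E y : form_apply Phi (xi y) a b = - 6 * xi y a b.
  have [_ /matrixP/(_ a b)] := xi7 y; rewrite !mxE invmx1.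
  have -> : \sum_k \sum_l \sum_a' \sum_b' Phi a b a' b' * eta a' k * eta b' l * xi y k l
     = form_apply Phi (xi y) a b.
    apply: eq_bigr => k _; apply: eq_bigr => l _.
    transitivity (\sum_a' (\sum_b' Phi a b a' b' * eta b' l) * eta a' k * xi y k l).
      apply: eq_bigr => a' _; rewrite !mulr_suml; apply: eq_bigr => b' _; ring.
    by rewrite -mulr_suml sum_mx1rC sum_mx1rC.
  lra.
have D1 : is_derive x (delta_mx 0 i) (fun y => form_apply Phi (xi y) a b)
    (form_apply Phi (dxi i) a b).
  do 2!apply: is_derive_bigsum => ?.
  exact: is_derive_cmul (pd_derivable _ _ (sxi _ _)).
apply: is_derive_uniq D1 _; apply: is_derive_ext (fun y => esym (E y)) _.
exact: is_derive_cmul (pd_derivable _ _ (sxi _ _)).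
Qed.

Lemma four_proj7_source i a p :
  four_proj7 Phi (torsion_source h xi x i) a p = dxi i a p + four_proj7 Phi (n i) a p.
Proof.
have E c d : torsion_source h xi x i c d = n i c d - (- 4^-1) * dxi i c d.
  by rewrite /torsion_source /n /dxi; ring.
rewrite /four_proj7 E.
have -> : form_apply Phi (torsion_source h xi x i) a p =
    form_apply Phi (n i) a p + 4^-1 * form_apply Phi (dxi i) a p.
  rewrite mulr_sumr -big_split; apply: eq_bigr => c _ /=.
  rewrite mulr_sumr -big_split; apply: eq_bigr => d _ /=; rewrite E; ring.
rewrite d1_xi_Lambda27; lra.
Qed.

Let N1 := null_dxi_dh h xi x.
Let N2 := null_dh_dh h xi x.
Let N3 := null_Phi_dh_dh Phi h xi x.
Let N4 := null_dxi_dtr h xi x.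
Let N5 := div_tr_h h xi x.
Let N6 := null_dxi_dxi h xi x.

Lemma source_norm_sq :
  \sum_i dot2 (four_proj7 Phi (torsion_source h xi x i))
              (four_proj7 Phi (torsion_source h xi x i)) =
  grad_sq xi x - 16 * div_div h xi x + 8 * grad_sq h x - 8 * div_div h h x
  + 16 * N1 - 8 * N2 - 4 * N3.
Proof.
have nN i a p : n i p a = - n i a p by rewrite /n; ring.
have S1 i : dot2 (four_proj7 Phi (torsion_source h xi x i))
    (four_proj7 Phi (torsion_source h xi x i)) =
  dot2 (dxi i) (dxi i) + 8 * dot2 (dxi i) (n i) + 4 * dot2 (n i) (n i)
  - 2 * dot2 (n i) (form_apply Phi (n i)).
  have H1 : dot2 (dxi i) (four_proj7 Phi (n i)) = 4 * dot2 (dxi i) (n i).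
    rewrite dot2_four_proj7 form_apply_self_adjoint //.
    have -> : dot2 (form_apply Phi (dxi i)) (n i) = - 6 * dot2 (dxi i) (n i).
      rewrite mulr_sumr; apply: eq_bigr => a _; rewrite mulr_sumr.
      by apply: eq_bigr => b _; rewrite d1_xi_Lambda27; ring.
    lra.
  have H2 : dot2 (four_proj7 Phi (n i)) (four_proj7 Phi (n i)) =
      4 * dot2 (n i) (n i) - 2 * dot2 (n i) (form_apply Phi (n i)).
    by rewrite (four_proj7_dot fPhi cid) // dot2_four_proj7; lra.
  transitivity (dot2 (dxi i) (dxi i) + 2 * dot2 (dxi i) (four_proj7 Phi (n i))
    + dot2 (four_proj7 Phi (n i)) (four_proj7 Phi (n i))); last first.
    by rewrite H1 H2; ring.
  rewrite mulr_sumr -!big_split; apply: eq_bigr => a _ /=.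
  rewrite mulr_sumr -!big_split; apply: eq_bigr => b _ /=.
  rewrite four_proj7_source; ring.
have X0 : \sum_i dot2 (dxi i) (dxi i) = grad_sq xi x.
  by do 3!(apply: eq_bigr => ? _); rewrite expr2.
(* The two halves of [n] contribute equally. [N1] exchanges the derivatives, leaving [d_p xi_ap]
   times the divergence of [h]; contraction on the second index of [xi] causes the sign. *)
have X1 : \sum_i dot2 (dxi i) (n i) = 2 * N1 - 2 * div_div h xi x.
  pose Y := \sum_i \sum_a \sum_p dxi i a p * d1 h p a i x.
  have Y1 : \sum_i dot2 (dxi i) (n i) = 2 * Y.
    have Y' : Y = \sum_i \sum_a \sum_p - (dxi i a p * d1 h a p i x).
      rewrite /Y; apply: eq_bigr => i _; rewrite exchange_big.
      by do 2!(apply: eq_bigr => ? _); rewrite /dxi xiN; ring.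
    transitivity (Y + Y); last by ring.
    rewrite {2}Y' -big_split; apply: eq_bigr => i _ /=.
    rewrite -big_split; apply: eq_bigr => a _; rewrite -big_split /=.
    by apply: eq_bigr => p _; rewrite /n; ring.
  have Y2 : Y - N1 = - div_div h xi x.
    transitivity (\sum_a (\sum_i d1 h i a i x) * (\sum_p dxi p a p)).
      transitivity (\sum_i \sum_a \sum_p dxi p a p * d1 h i a i x).
        rewrite -sumrB; apply: eq_bigr => i _; rewrite -sumrB; apply: eq_bigr => a _.
        rewrite -sumrB; apply: eq_bigr => p _.
        by rewrite /null_lagrangian /component /= /dxi /d1; ring.
      rewrite exchange_big; apply: eq_bigr => a _; rewrite mulr_suml.
      by apply: eq_bigr => i _; rewrite mulr_sumr; apply: eq_bigr => p _; rewrite mulrC.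
    rewrite -sumrN; apply: eq_bigr => a _; rewrite /div2 -mulrN -sumrN.
    congr (_ * _); apply: eq_bigr => i _; first exact: hC.
    by rewrite /dxi xiN.
  by rewrite Y1; lra.
have X2 : \sum_i dot2 (n i) (n i) = 2 * grad_sq h x - 2 * div_div h h x - 2 * N2.
  pose G := grad_sq h x.
  pose Y := \sum_p \sum_a \sum_i d1 h p a i x * d1 h a p i x.
  have Y1 : Y - N2 = div_div h h x.
    transitivity (\sum_p \sum_a \sum_i d1 h a a i x * d1 h p p i x).
      rewrite -sumrB; apply: eq_bigr => p _; rewrite -sumrB; apply: eq_bigr => a _.
      rewrite -sumrB; apply: eq_bigr => i _.
      by rewrite /null_lagrangian /component /= /d1; ring.
    under eq_bigr do rewrite exchange_big; rewrite exchange_big.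
    apply: eq_bigr => i _; rewrite /div2 mulrC mulr_suml; apply: eq_bigr => p _.
    by rewrite mulr_sumr; apply: eq_bigr => a _; rewrite mulrC.
  have Y2 : \sum_i dot2 (n i) (n i) = G + G - 2 * Y.
    have G1 : G = \sum_i \sum_a \sum_p d1 h p a i x ^+ 2.
      rewrite /G /grad_sq exchange_big [RHS]exchange_big; apply: eq_bigr => a _.
      by rewrite exchange_big.
    have G2 : G = \sum_i \sum_a \sum_p d1 h a p i x ^+ 2.
      by rewrite G1; apply: eq_bigr => i _; rewrite exchange_big.
    have Y' : Y = \sum_i \sum_a \sum_p d1 h p a i x * d1 h a p i x.
      rewrite /Y exchange_big [RHS]exchange_big; apply: eq_bigr => a _.
      by rewrite exchange_big.
    rewrite {1}G1 G2 Y' mulr_sumr -big_split -sumrB; apply: eq_bigr => i _ /=.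
    rewrite mulr_sumr -big_split -sumrB; apply: eq_bigr => a _ /=.
    rewrite mulr_sumr -big_split -sumrB; apply: eq_bigr => p _ /=.
    by rewrite /n; ring.
  by rewrite Y2 -/G; lra.
(* This term is entirely a divergence: antisymmetry of [Phi] in the two derivative indices [p] and
   [d] antisymmetrises the derivatives. *)
have X3 : \sum_i dot2 (n i) (form_apply Phi (n i)) = 2 * N3.
  rewrite mulr_sumr; apply: eq_bigr => i _.
  pose Q := sum4 (fun a p c d => Phi a p c d * (d1 h p a i x * d1 h d c i x)).
  have Q1 : dot2 (n i) (form_apply Phi (n i)) = Q + Q + Q + Q.
    have q2 : Q = sum4 (fun a p c d => - Phi a p c d * (d1 h a p i x * d1 h d c i x)).
      by rewrite /Q sum4_12; apply: eq_sum4 => a p c d; rewrite (form4_12 fPhi).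
    have q3 : Q = sum4 (fun a p c d => - Phi a p c d * (d1 h p a i x * d1 h c d i x)).
      by rewrite /Q sum4_34; apply: eq_sum4 => a p c d; rewrite (form4_34 fPhi).
    have q4 : Q = sum4 (fun a p c d => Phi a p c d * (d1 h a p i x * d1 h c d i x)).
      rewrite q2 sum4_34; apply: eq_sum4 => a p c d; rewrite (form4_34 fPhi); ring.
    rewrite {2}q2 {2}q3 {1}q4 /Q -!sum4D.
    apply: eq_bigr => a _; apply: eq_bigr => p _; rewrite mulr_sumr.
    apply: eq_bigr => c _; rewrite mulr_sumr; apply: eq_bigr => d _.
    rewrite /n; ring.
  have Q2 : \sum_a \sum_p \sum_c \sum_d Phi a p c d *
      null_lagrangian p d (false, a, i) (false, c, i) h xi x = Q + Q.
    have q2 : Q = sum4 (fun a p c d => - Phi a p c d * (d1 h d a i x * d1 h p c i x)).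
      by rewrite /Q sum4_24; apply: eq_sum4 => a p c d; rewrite (form4_24 fPhi).
    rewrite {2}q2 /Q -sum4D; apply: eq_sum4 => a p c d.
    by rewrite /null_lagrangian /component /= /d1; ring.
  by rewrite Q1 Q2; ring.
rewrite (eq_bigr _ (fun i _ => S1 i)) sumrB !big_split /= -!mulr_sumr X0 X1 X2 X3.
ring.
Qed.

End LinearisedAction.

Section LinearisedTrace.
Variables (R : realType) (Phi : tensor4 R).
Hypotheses (fPhi : is_form4 Phi) (cid : cayley_identity 1%:M Phi).
Variables (h xi : 'rV[R]_8 -> 'M[R]_8).
Hypotheses (sh : smooth2 h) (sxi : smooth2 xi).
Hypotheses (hT : forall x, (h x)^T = h x) (xi7 : forall x, in_Lambda27 1%:M Phi (xi x)).
Variable x : 'rV[R]_8.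
Local Notation eta := (1%:M : 'M[R]_8).

Let hC i a b : d1 h i b a x = d1 h i a b x.
Proof. exact: d1_sym. Qed.

Let xiN i a b : d1 xi i b a x = - d1 xi i a b x.
Proof. by apply: d1_anti => // y; have [] := xi7 y. Qed.

Let N4 := null_dxi_dtr h xi x.
Let N5 := div_tr_h h xi x.
Let N6 := null_dxi_dxi h xi x.

Lemma pd_tr a : pd a (fun y => \tr (h y)) x = \sum_c d1 h a c c x.
Proof.
have H : is_derive x (delta_mx 0 a) (fun y => \tr (h y)) (\sum_c d1 h a c c x).
  by apply: is_derive_bigsum => c; apply: pd_derivable.
by have [_ <-] := H.
Qed.

Lemma source_trace p :
  \sum_i four_proj7 Phi (torsion_source h xi x i) i p =
  div2 xi p x + \sum_c d1 h p c c x - div2 h p x.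
Proof.
under eq_bigr do rewrite (four_proj7_source h sxi xi7).
pose n i a p := d1 h p a i x - d1 h a p i x.
(* [Phi_ipcd] is antisymmetric in [i, c], while the derivative of [h_ci] is symmetric there. *)
have Z : \sum_i form_apply Phi (n i) i p = 0.
  have Z1 : \sum_i \sum_c \sum_d Phi i p c d * d1 h d c i x = 0.
    transitivity (\sum_d \sum_i \sum_c Phi i p c d * d1 h d c i x).
      by rewrite [RHS]exchange_big; apply: eq_bigr => i _; rewrite [RHS]exchange_big.
    apply: big1 => d _; apply: sum2_anti0 => i c.
    by rewrite (form4_13 fPhi i p c d) hC; ring.
  transitivity (\sum_i \sum_c \sum_d Phi i p c d * d1 h d c i x
    + \sum_i \sum_c \sum_d Phi i p c d * d1 h d c i x); last by rewrite Z1 addr0.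
  rewrite -big_split; apply: eq_bigr => i _ /=.
  rewrite {2}exchange_big -big_split; apply: eq_bigr => c _ /=.
  rewrite -big_split; apply: eq_bigr => d _ /=.
  rewrite (form4_34 fPhi i p c d) /n; ring.
transitivity (\sum_i (d1 xi i i p x + d1 h p i i x - d1 h i p i x)
   - 2^-1 * \sum_i form_apply Phi (n i) i p).
  rewrite mulr_sumr -sumrB; apply: eq_bigr => i _; rewrite /four_proj7 -/(n _) /n; ring.
rewrite Z mulr0 subr0 sumrB big_split /=; congr (_ + _ - _).
by apply: eq_bigr => i _; rewrite hC.
Qed.

Lemma source_trace_sq :
  \sum_p (\sum_i four_proj7 Phi (torsion_source h xi x i) i p) ^+ 2 =
  8^-1 * grad_sq xi x + grad_tr_sq h x + div_div h h x - 2 * div_div h xi x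
  + 2 * tr_ddiv h x + (N4 - 2 * N5 - 2^-1 * N6).
Proof.
pose T p := \sum_c d1 h p c c x.
pose Dxx := \sum_p div2 xi p x * div2 xi p x.
pose Y1 := \sum_p div2 xi p x * T p.
pose Y2 := \sum_p T p * div2 h p x.
(* Renaming [a] and [p] changes the sign of [xi_ap], so the product of the divergence of [xi] with
   the gradient of the trace is half of a null Lagrangian. *)
have E1 : Y1 = 2^-1 * N4.
  pose Y1' := \sum_a \sum_p \sum_c d1 xi a a p x * d1 h p c c x.
  have A : Y1 = Y1'.
    rewrite /Y1' exchange_big; apply: eq_bigr => p _; rewrite mulr_suml.
    by apply: eq_bigr => a _; rewrite mulr_sumr.
  have B : Y1' = \sum_a \sum_p \sum_c - (d1 xi p a p x * d1 h a c c x).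
    rewrite /Y1' exchange_big; do 3!(apply: eq_bigr => ? _).
    by rewrite xiN; ring.
  have C : N4 = Y1' + Y1'.
    rewrite {2}B -big_split; apply: eq_bigr => a _ /=; rewrite -big_split.
    by apply: eq_bigr => p _ /=; rewrite -big_split.
  by rewrite A C; lra.
have E2 : Y2 = N5 - tr_ddiv h x.
  have A : tr_ddiv h x = \sum_a \sum_b \sum_c h x c c * pd a (d1 h b a b) x.
    rewrite /tr_ddiv mulr_sumr; apply: eq_bigr => a _; rewrite mulr_sumr.
    by apply: eq_bigr => b _; rewrite mulr_suml.
  have B : Y2 = \sum_a \sum_b \sum_c d1 h a c c x * d1 h b a b x.
    apply: eq_bigr => a _; rewrite mulr_sumr; apply: eq_bigr => b _.
    by rewrite mulr_suml; apply: eq_bigr => c _; rewrite (hC b a b).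
  rewrite A B -sumrB; apply: eq_bigr => a _; rewrite -sumrB; apply: eq_bigr => b _.
  rewrite -sumrB; apply: eq_bigr => c _.
  by rewrite /divergence_term /component /= addrK.
have E3 : Dxx = 8^-1 * grad_sq xi x - 2^-1 * N6.
  have D2 : Dxx = \sum_a \sum_c \sum_e d1 xi a a e x * d1 xi c c e x.
    under [RHS]eq_bigr do rewrite exchange_big.
    rewrite [RHS]exchange_big; apply: eq_bigr => e _; rewrite mulr_suml.
    by apply: eq_bigr => a _; rewrite mulr_sumr.
  (* [Dxx + N6] is the square of the divergence with its derivatives exchanged. Adding [Dxx]
     produces the anticommutator of [d_a xi] and [d_c xi], and the Clifford relation leaves only
     [a = c]. *)
  have D3 : Dxx + (Dxx + N6) = 4^-1 * grad_sq xi x.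
    have g2 : grad_sq xi x = \sum_a \sum_c eta a c *
        dot2 (fun b e => d1 xi a b e x) (fun b e => d1 xi c b e x).
      apply: eq_bigr => a _; rewrite sum_mx1l.
      by do 2!(apply: eq_bigr => ? _); rewrite expr2.
    rewrite g2 D2 -!big_split mulr_sumr; apply: eq_bigr => a _ /=.
    rewrite -!big_split mulr_sumr; apply: eq_bigr => c _ /=.
    rewrite -(Lambda27_anticommute fPhi cid) => [|b e|b e|b e|b e];
      [|exact: xiN|exact: xiN|exact: d1_xi_Lambda27|exact: d1_xi_Lambda27].
    rewrite -!big_split; apply: eq_bigr => e _ /=.
    rewrite /null_lagrangian /component /= -!/(d1 _ _ _ _ _); ring.
  lra.
transitivity (Dxx + grad_tr_sq h x + div_div h h x + 2 * Y1 - 2 * div_div h xi x - 2 * Y2).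
  rewrite !mulr_sumr -!sumrN -!big_split; apply: eq_bigr => p _ /=.
  rewrite source_trace pd_tr -/(T p); ring.
rewrite E1 E2 E3; lra.
Qed.

End LinearisedTrace.

Theorem mainTheorem9 (R : realType) (kappa : R) (Phi : tensor4 R)
    (hkappa1 : kappa != 1) (hkappa6 : kappa != - 6)
    (hPhi : cayley_form Phi) (hmetric : metric_of Phi 1%:M) :
  let rho := 1 + kappa / 6 in
  let mu := 2 / 3 * (1 + kappa / 2) in
  let c := 1 - 5 * kappa / 6 - kappa ^+ 2 / 6 in
  eq_mod_total_derivatives Phi
    (fun h xi t x => c * L2 kappa Phi t x)
    (fun h xi t x => rho * L_GR h x + mu * L_prime h xi x)
  /\
  eq_mod_total_derivatives Phi
    (fun h xi t x => c * L2 kappa Phi t x)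
    (fun h xi t x =>
       1 / 2 * (1 + kappa / 6) * grad_sq h x
       - 1 / 6 * (1 - kappa / 2) * grad_tr_sq h x
       - 1 / 3 * (1 - kappa / 2) * tr_ddiv h x
       - 2 / 3 * div_div h h x
       + 1 / 24 * (1 + kappa / 2) * grad_sq xi x
       - 2 / 3 * (1 + kappa / 2) * div_div h xi x).
Proof.
move=> rho mu c.
have fPhi := cayley_form_is_form4 hPhi; have [_ _ cid _] := hmetric.
suff main : eq_mod_total_derivatives Phi
    (fun h xi t x => c * L2 kappa Phi t x)
    (fun h xi t x =>
       1 / 2 * (1 + kappa / 6) * grad_sq h x
       - 1 / 6 * (1 - kappa / 2) * grad_tr_sq h x
       - 1 / 3 * (1 - kappa / 2) * tr_ddiv h x
       - 2 / 3 * div_div h h x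
       + 1 / 24 * (1 + kappa / 2) * grad_sq xi x
       - 2 / 3 * (1 + kappa / 2) * div_div h xi x).
  (* The two right-hand sides are identical as polynomials in the quadratic terms, so one current
     serves both. *)
  split => //; have [C HC] := main; exists C => h xi t sh sxi hT xi7 tv x.
  rewrite (HC h xi t) //; congr (_ + _).
  by rewrite /rho /mu /L_GR /L_prime; lra.
have [C HC] := total_derivative_boundary kappa Phi.
exists C => h xi t sh sxi hT xi7 tv x; rewrite -(HC h xi) //.
have xiT y : (xi y)^T = - xi y by have [] := xi7 y.
have proj7E i : four_proj7 Phi (t x i) = four_proj7 Phi (torsion_source h xi x i).
  apply/funext => a; apply/funext => p.
  exact: (torsion_variation_proj7 fPhi hmetric sh sxi hT xiT tv).
rewrite /L2 (action_density_flat fPhi cid hkappa1 hkappa6 (torsion_variation_form3 tv x)).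
under eq_bigr do rewrite proj7E.
under [X in _ - _ * X]eq_bigr do (under eq_bigr do rewrite proj7E).
rewrite (source_norm_sq fPhi cid sxi hT xi7) (source_trace_sq fPhi cid sh sxi hT xi7).
lra.
Qed.
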